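(* Let $(X,d,\mu)$ be a metric-measure space and fix $p\in[1,\infty)$. Then the following two statements are equivalent. (a) The measure $\mu$ is doubling and the space $(X,d,\mu)$ supports a $p$-Poincaré inequality. (b) There exist $q\in(p,\infty)$, $C_P\in[1,\infty)$, and $\sigma\in[1,\infty)$ such that $$\left(\frac{1}{\mu(B)}\int_{B}|u-u_{B}|^{q}\,d\mu\right)^{1/q}\leq C_P\,r\left(\frac{1}{\mu(\sigma B)}\int_{\sigma B}g^{p}\,d\mu\right)^{1/p}$$ whenever $B$ is a ball of radius $r\in(0,\infty)$, $u\in L^1_{\rm loc}(X,\mu)$, and $g:X\to[0,\infty]$ is an upper gradient of $u$.
   Context: A metric-measure space $(X,d,\mu)$ is a metric space $(X,d)$ with a Borel measure $\mu$ such that $0<\mu(B(x,r))<\infty$ for all $x\in X$ and all $r\in(0,\infty)$, where $B(x,r):=\{y\in X: d(x,y)<r\}$ is the open ball with center $x$ and radius $r$. For a ball $B=B(x,r)$ and $\tau\in(0,\infty)$, $\tau B:=B(x,\tau r)$. (A ball is understood to come with a specified center and radius.) The measure $\mu$ is doubling if there exists a finite constant $C>0$ such that $\mu(2B)\le C\mu(B)$ for all balls $B\subseteq X$. For a $\mu$-measurable set $E$ of positive (finite) measure, $f_E:=\frac{1}{\mu(E)}\int_E f\,d\mu$ denotes the integral average. $L^1_{\rm loc}(X,\mu)$ denotes the locally integrable functions, understood as functions integrable on every ball, so that the averages $u_B$ are well defined. Functions $u\in L^1_{\rm loc}(X,\mu)$ are always assumed to be everywhere finite Borel representatives $u:X\to\mathbb{R}$.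 A Borel function $g:X\to[0,\infty]$ is an upper gradient of a Borel function $u:X\to\mathbb{R}$ if $|u(x)-u(y)|\le\int_{\gamma_{xy}}g\,ds$ holds for each $x,y\in X$ and all rectifiable curves $\gamma_{xy}$ joining $x$ and $y$. For $p\in[1,\infty)$, the space $(X,d,\mu)$ supports a $p$-Poincaré inequality if there exist constants $C\in(0,\infty)$ and $\sigma\in[1,\infty)$ such that $$\frac{1}{\mu(B)}\int_{B}|u-u_{B}|\,d\mu\le C\,r\left(\frac{1}{\mu(\sigma B)}\int_{\sigma B}g^{p}\,d\mu\right)^{1/p}$$ whenever $B$ is a ball of radius $r\in(0,\infty)$, $u\in L^1_{\rm loc}(X,\mu)$, and $g:X\to[0,\infty]$ is an upper gradient of $u$. *)

(* Defs.v *)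
From HB Require Import structures.
From mathcomp Require Import all_boot all_order all_algebra.
From mathcomp Require Import all_classical all_reals all_analysis measurable_realfun.

Set Implicit Arguments.
Unset Strict Implicit.
Unset Printing Implicit Defensive.

Import Order.TTheory GRing.Theory Num.Theory.
Import numFieldNormedType.Exports.

Local Open Scope classical_set_scope.
Local Open Scope ring_scope.

HB.mixin Record Measurable_isBorel (d : measure_display) T
    & Topological T & Measurable d T := {
  measurable_borel : (measurable : set (set T)) = <<s open >>
}.

(* Metric spaces whose measurable sets are exactly the Borel sets. The library's
   measurable types are pointed, so the carrier is nonempty. *)
#[short(type="borelMetricType")]
HB.structure Definition BorelMetric (R : numDomainType) (d : measure_display) :=
  {T of Metric R T & Measurable d T & Measurable_isBorel d T}.

Section curves.
Context {R : realType} {X : metricType R}.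
Implicit Types (a b s t : R) (gamma : R -> X).

(* The metric counterpart of [variation], which is for [R]-valued maps. *)
Definition mvariation a b gamma (l : seq R) : R :=
  let F := gamma \o nth b (a :: l) in
  \sum_(0 <= n < size l) mdist (F n) (F n.+1).

(* Curves are continuous maps on a compact interval [a, b]; the values of
   [gamma] outside of [a, b] play no role. *)
Definition curve_length a b gamma : \bar R :=
  ereal_sup [set (mvariation a b gamma l)%:E | l in itv_partition a b].

Definition rectifiable_curve a b gamma : Prop :=
  [/\ a <= b, {within `[a, b], continuous gamma}
    & (curve_length a b gamma < +oo)%E].

(* The arc-length parametrization: the point reached by [gamma] after a length
   [s]. All times [t] at which the length from [a] to [t] is [s] give the same
   point, so the choice made by [xget] is immaterial; such times exist for
   every [s] between 0 and the length of a rectifiable curve. *)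
Definition arc_param a b gamma s : X :=
  gamma (xget a [set t | t \in `[a, b] /\ curve_length a t gamma = s%:E]).

Definition line_integral a b gamma (g : X -> \bar R) : \bar R :=
  (\int[lebesgue_measure]_(s in `[0%R, fine (curve_length a b gamma)])
     g (arc_param a b gamma s))%E.

End curves.

Section metric_measure.
Context {R : realType} {d : measure_display} {X : borelMetricType R d}.
Variable mu : {measure set X -> \bar R}.
Implicit Types (u : X -> R) (g : X -> \bar R) (E : set X).

Definition metric_measure_space : Prop :=
  forall (x : X) (r : R), 0 < r -> (0 < mu (ball x r) < +oo)%E.

Definition doubling : Prop :=
  exists2 C : R, 0 < C & forall (x : X) (r : R), 0 < r ->
    (mu (ball x (2 * r)) <= C%:E * mu (ball x r))%E.

Definition average E (f : X -> \bar R) : \bar R :=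
  ((mu E)^-1 * \int[mu]_(y in E) f y)%E.

Definition raverage E u : R := fine (average E (EFin \o u)).

Definition L1loc u : Prop :=
  measurable_fun setT u /\
  forall (x : X) (r : R), 0 < r -> mu.-integrable (ball x r) (EFin \o u).

Definition upper_gradient u g : Prop :=
  [/\ measurable_fun setT g, (forall x, (0 <= g x)%E) &
    forall (x y : X) (a b : R) (gamma : R -> X),
      rectifiable_curve a b gamma -> gamma a = x -> gamma b = y ->
      (`|u x - u y|%:E <= line_integral a b gamma g)%E].

Definition supports_poincare (p : R) : Prop :=
  exists C sigma : R, [/\ 0 < C, 1 <= sigma &
    forall (x : X) (r : R) u g, 0 < r -> L1loc u -> upper_gradient u g ->
      (average (ball x r) (fun y => `|u y - raverage (ball x r) u|%:E) <=
       (C * r)%:E *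
         (average (ball x (sigma * r)) (fun y => g y `^ p)) `^ p^-1)%E].

End metric_measure.

(* Main.v *)
(** From (b) to (a): Jensen gives the Poincare inequality. For doubling, test the
    inequality on the ball B(x,2r) with cutoffs between the concentric balls of
    radii r_j = r (1/2 + 2^-(j+1)); with a_j = mu(B(x,r_j)) / mu(B(x,2r)) this gives
    a_(j+1)^(1/q) <= K 2^j a_j^(1/p), and since q > p a De Giorgi iteration would
    force a_j -> 0 if a_0 were small, contradicting a_j >= mu(B(x,r/2)) / mu(B(x,2r)).

    From (a) to (b): cover B = B(x,r) at each scale r/4^i by balls centred at a
    separated net, and let u_i be the average of u over the chosen ball. The
    Poincare inequality alone shows that u_i -> u in L^1 at a geometric rate, hence
    almost everywhere, so neither maximal functions nor Lebesgue points are needed.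
    The increments |u_i - u_(i+1)| are at most K r 4^-i t_i^(1/p), where t_i is an
    average of g^p over a ball at scale i; doubling bounds t_i by a constant times
    D^(2i) times the average of g^p over a dilate of B, so a small part e of the
    exponent 1 + e = q/p of t_i is absorbed by the factor 4^-i, while the remaining
    power t_i integrates to at most a constant times the integral of g^p because
    the balls have bounded overlap. *)

Require Import Defs.
From mathcomp Require Import all_boot all_order all_algebra.
From mathcomp Require Import all_classical all_reals all_analysis measurable_realfun.
From mathcomp Require Import ring lra.

Set Implicit Arguments.
Unset Strict Implicit.
Unset Printing Implicit Defensive.

Import Order.TTheory GRing.Theory Num.Theory.
Import numFieldNormedType.Exports.

Local Open Scope classical_set_scope.
Local Open Scope ring_scope.

(** * Arc length of curves in metric spaces *)

Section curves.
Context {R : realType} {X : metricType R}.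
Implicit Types (a b c s t : R) (gamma : R -> X) (l : seq R).

Lemma mvariation_nil a b gamma : mvariation a b gamma [::] = 0.
Proof. by rewrite /mvariation big_nil. Qed.

Lemma mvariation_cons a b gamma x l :
  mvariation a b gamma (x :: l) = mdist (gamma a) (gamma x) + mvariation x b gamma l.
Proof. by rewrite /mvariation/= big_nat_recl. Qed.

Lemma mvariation_ge0 a b gamma l : 0 <= mvariation a b gamma l.
Proof. by apply: sumr_ge0 => i _; exact: mdist_ge0. Qed.

Lemma mvariation_cat a b c gamma l1 l2 : last a l1 = c ->
  mvariation a b gamma (l1 ++ l2) = mvariation a c gamma l1 + mvariation c b gamma l2.
Proof.
elim: l1 a => [|x l1 ih] a /=; first by move=> ->; rewrite mvariation_nil add0r.
by move=> /ih ac; rewrite !mvariation_cons ac addrA.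
Qed.

(** Inserting [c] into the partition can only increase the variation, by the triangle inequality on
    the interval that contains it. *)
Lemma mvariation_split a b c gamma l : a <= c -> c <= b -> itv_partition a b l ->
  exists l1 l2, [/\ itv_partition a c l1, itv_partition c b l2 &
    mvariation a b gamma l <= mvariation a c gamma l1 + mvariation c b gamma l2].
Proof.
elim: l a => [|x l ih] a ac cb.
  move=> /itv_partition_nil ab; subst b.
  have {cb ac} -> : c = a by apply/eqP; rewrite eq_le ac cb.
  exists [::], [::]; split; [by split => //=|by split => //=|].
  by rewrite !mvariation_nil addr0.
move=> abxl; have xbl := itv_partition_cons abxl.
have ax : a < x by move: abxl => [/= /andP[]].
have [xc|cx] := ltP x c.
  have [l1 [l2 [h1 h2 h]]] := ih _ (ltW xc) cb xbl.
  exists (x :: l1), l2; split => //.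
    by move: h1 => [p1 q1]; split => //=; rewrite ax.
  by rewrite !mvariation_cons -addrA lerD2l.
move: ac; rewrite le_eqVlt => /predU1P[<-|{}ac].
  by exists [::], (x :: l); split => //; rewrite mvariation_nil add0r.
move: cx; rewrite le_eqVlt => /predU1P[cx|cx].
  rewrite cx; exists [:: x], l; split => //; first exact: itv_partition1.
  by rewrite !mvariation_cons mvariation_nil addr0.
exists [:: c], (x :: l); split => //; first exact: itv_partition1.
  by case: xbl => p1 q1; split => //=; rewrite cx.
rewrite !mvariation_cons mvariation_nil addr0 addrA lerD2r.
exact: metric_triangle.
Qed.

Lemma curve_length_ub a b gamma l : itv_partition a b l ->
  ((mvariation a b gamma l)%:E <= curve_length a b gamma)%E.
Proof. by move=> abl; apply: ereal_sup_ubound; exists l. Qed.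

Lemma curve_length_le a b gamma (M : \bar R) :
  (forall l, itv_partition a b l -> ((mvariation a b gamma l)%:E <= M)%E) ->
  (curve_length a b gamma <= M)%E.
Proof. by move=> h; apply: ge_ereal_sup => _ [l abl <-]; exact: h. Qed.

Lemma curve_length_xx a gamma : curve_length a a gamma = 0%E.
Proof.
apply/eqP; rewrite eq_le; apply/andP; split.
  by apply: curve_length_le => l /itv_partitionxx ->; rewrite mvariation_nil.
by rewrite -[leLHS](congr1 EFin (mvariation_nil a a gamma)); apply: curve_length_ub; split => /=.
Qed.

Lemma itv_partition_ex a b : a <= b -> exists l, itv_partition a b l.
Proof.
rewrite le_eqVlt => /predU1P[<-|ab]; first by exists [::]; split => /=.
by exists [:: b]; exact: itv_partition1.
Qed.

Lemma curve_length_ge0 a b gamma : a <= b -> (0 <= curve_length a b gamma)%E.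
Proof.
move=> /itv_partition_ex[l abl]; apply: le_trans (curve_length_ub gamma abl).
by rewrite lee_fin mvariation_ge0.
Qed.

Lemma mdist_le_curve_length a b gamma : a <= b ->
  ((mdist (gamma a) (gamma b))%:E <= curve_length a b gamma)%E.
Proof.
rewrite le_eqVlt => /predU1P[<-|ab]; first by rewrite mdistxx curve_length_ge0.
apply: le_trans (curve_length_ub gamma (itv_partition1 ab)).
by rewrite mvariation_cons mvariation_nil addr0.
Qed.

Lemma curve_length_fin_num a b gamma : a <= b -> (curve_length a b gamma < +oo)%E ->
  curve_length a b gamma \is a fin_num.
Proof. by move=> ab h; rewrite ge0_fin_numE// curve_length_ge0. Qed.

(** Concatenating partitions at [c] gives one inequality and [mvariation_split] the other.
    Finiteness of the total length allows the suprema over the two pieces to be taken one after the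
    other by subtraction in [R]. *)
Lemma curve_lengthD a b c gamma : a <= c -> c <= b ->
  (curve_length a b gamma < +oo)%E ->
  (curve_length a c gamma + curve_length c b gamma = curve_length a b gamma)%E.
Proof.
move=> ac cb abfin.
have abE := fineK (curve_length_fin_num (le_trans ac cb) abfin).
set M := fine _ in abE.
have H l1 l2 : itv_partition a c l1 -> itv_partition c b l2 ->
    mvariation a c gamma l1 + mvariation c b gamma l2 <= M.
  move=> h1 h2; rewrite -lee_fin abE -(@mvariation_cat a b c).
    by apply: curve_length_ub; exact: itv_partition_cat h1 h2.
  by case: h1 => _ /eqP.
have h2 l1 : itv_partition a c l1 ->
    (curve_length c b gamma <= (M - mvariation a c gamma l1)%:E)%E.
  move=> h1; apply: curve_length_le => l2 h2.
  by rewrite lee_fin lerBrDl H.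
have cbfin : (curve_length c b gamma < +oo)%E.
  have [l1 h1] := itv_partition_ex ac.
  by apply: le_lt_trans (h2 _ h1) _; rewrite ltry.
have cbE := fineK (curve_length_fin_num cb cbfin).
set N := fine _ in cbE.
apply/eqP; rewrite eq_le; apply/andP; split.
  rewrite -cbE -leeBrDr// -abE -EFinB; apply: curve_length_le => l1 h1.
  by move: (h2 _ h1); rewrite -cbE !lee_fin lerBrDl lerBrDr.
apply: curve_length_le => l /(mvariation_split gamma ac cb)[l1 [l2 [h1 h3 h4]]].
apply: (@le_trans _ _ (mvariation a c gamma l1 + mvariation c b gamma l2)%:E).
  by rewrite lee_fin.
by rewrite EFinD leeD// curve_length_ub.
Qed.

Lemma within_continuous_mdist a b gamma t e : {within `[a, b], continuous gamma} ->
  t \in `[a, b] -> 0 < e -> exists2 d, 0 < d &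
    forall t', t' \in `[a, b] -> `|t - t'| < d -> mdist (gamma t) (gamma t') < e.
Proof.
move=> /subspace_continuousP gc tab e0.
have := gc t tab => /metricType_numDomainType.cvgrPdist_lt /(_ e e0).
rewrite near_withinE => -[d /= d0 hd]; exists d => // t' t'ab tt'.
exact: hd.
Qed.

Lemma curve_length_split_fin a b t gamma : rectifiable_curve a b gamma ->
  t \in `[a, b] -> [/\ curve_length a t gamma \is a fin_num,
    curve_length t b gamma \is a fin_num &
    fine (curve_length a t gamma) + fine (curve_length t b gamma) =
    fine (curve_length a b gamma)].
Proof.
move=> [ab _ fab]; rewrite in_itv/= => /andP[at_ tb].
have := curve_lengthD at_ tb fab.
have := curve_length_fin_num ab fab.
have := curve_length_ge0 gamma at_; have := curve_length_ge0 gamma tb.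
case: (curve_length a t gamma) => [x| |]//; case: (curve_length t b gamma) => [y| |]//.
all: move=> _ _ + cE; rewrite -cE//.
Qed.

End curves.

Section arc_length.
Context {R : realType} {X : metricType R}.
Implicit Types (a b c s t : R) (gamma : R -> X) (l : seq R).

Lemma rectifiable_curve_sub a b c t gamma : rectifiable_curve a b gamma ->
  a <= c -> c <= t -> t <= b -> rectifiable_curve c t gamma.
Proof.
move=> rg ac ct tb; have [ab cg fab] := rg; split => //.
  apply: continuous_subspaceW cg; apply: subset_itv; by rewrite bnd_simp.
have tab : t \in `[a, b] by rewrite in_itv/= tb (le_trans ac ct).
have [fat _ _] := curve_length_split_fin rg tab.
have := curve_lengthD (gamma := gamma) ac ct.
rewrite -ge0_fin_numE ?fat ?curve_length_ge0 ?(le_trans ac)// => /(_ isT) h.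
rewrite -ge0_fin_numE ?curve_length_ge0//.
by move: fat; rewrite -h fin_numD => /andP[].
Qed.

Lemma fine_curve_lengthD a b c gamma : rectifiable_curve a b gamma ->
  a <= c -> c <= b ->
  fine (curve_length a b gamma) =
  fine (curve_length a c gamma) + fine (curve_length c b gamma).
Proof.
move=> rg ac cb; have cab : c \in `[a, b] by rewrite in_itv/= ac cb.
by have [_ _ ->] := curve_length_split_fin rg cab.
Qed.

Lemma rectifiable_curve_lengthE a b gamma : rectifiable_curve a b gamma ->
  curve_length a b gamma = (fine (curve_length a b gamma))%:E.
Proof. by move=> [ab _ fab]; rewrite fineK// curve_length_fin_num. Qed.

Lemma mdist_le_fine a b gamma : rectifiable_curve a b gamma ->
  mdist (gamma a) (gamma b) <= fine (curve_length a b gamma).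
Proof.
move=> rg; rewrite -lee_fin -rectifiable_curve_lengthE//.
by apply: mdist_le_curve_length; case: rg.
Qed.

Lemma curve_length_adherent a b gamma e : rectifiable_curve a b gamma -> 0 < e ->
  exists2 l, itv_partition a b l &
    fine (curve_length a b gamma) - e < mvariation a b gamma l.
Proof.
move=> rg e0; have rgE := rectifiable_curve_lengthE rg.
have : curve_length a b gamma \is a fin_num by rewrite rgE.
by move=> /(ub_ereal_sup_adherent e0)[_ [l abl <-]]; rewrite -/(curve_length _ _ _) rgE;
  rewrite -EFinB lte_fin; exists l.
Qed.

(** Right-continuity of arc length at [a]. For [t] before the first division point of a partition
    that is [e / 2]-optimal, inserting [t] shows that the length from [a] to [t] is at most
    [e / 2 + mdist (gamma a) (gamma t)]; continuity makes the distance smaller than [e / 2]. *)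
Lemma curve_length_small_right a b gamma e : rectifiable_curve a b gamma ->
  a < b -> 0 < e -> exists y, [/\ a < y, y <= b &
    forall t, a < t -> t < y -> fine (curve_length a t gamma) <= e].
Proof.
move=> rg ab e0; have e20 : 0 < e / 2 by rewrite divr_gt0.
have [l abl hl] := curve_length_adherent rg e20.
have cg : {within `[a, b], continuous gamma} by case: rg.
have aab : a \in `[a, b] by rewrite in_itv/= lexx ltW.
have [d d0 hd] := within_continuous_mdist cg aab e20.
case: l abl hl => [/itv_partition_nil /eqP|x l abl hl]; first by rewrite lt_eqF.
have ax : a < x by move: abl => [/= /andP[]].
have xbl := itv_partition_cons abl.
have xb := itv_partition_le xbl.
exists (Num.min x (a + d)); split.
- by rewrite lt_min ax ltrDl.
- by rewrite ge_min xb.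
move=> t at_; rewrite lt_min => /andP[tx tad].
have tb : t <= b by rewrite ltW// (lt_le_trans tx).
have := hd t; rewrite in_itv/= (ltW at_) tb => /(_ isT).
rewrite distrC gtr0_norm ?subr_gt0// ltrBlDl tad => /(_ isT) hat.
have htb : mvariation t b gamma (x :: l) <= fine (curve_length t b gamma).
  have rtb := rectifiable_curve_sub rg (ltW at_) tb (lexx _).
  rewrite -lee_fin -rectifiable_curve_lengthE//; apply: curve_length_ub.
  by case: xbl => p q; split => //=; rewrite tx.
move: hl htb; rewrite (fine_curve_lengthD rg (ltW at_) tb) !mvariation_cons.
have := metric_triangle (gamma a) (gamma t) (gamma x).
lra.
Qed.

(** The mirror image at [b]: the optimal partition is opened at its last interval, hence the use of
    [lastP]. *)
Lemma curve_length_small_left a b gamma e : rectifiable_curve a b gamma ->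
  a < b -> 0 < e -> exists y, [/\ a <= y, y < b &
    forall t, y < t -> t < b -> fine (curve_length t b gamma) <= e].
Proof.
move=> rg ab e0; have e20 : 0 < e / 2 by rewrite divr_gt0.
have [l abl hl] := curve_length_adherent rg e20.
have cg : {within `[a, b], continuous gamma} by case: rg.
have bab : b \in `[a, b] by rewrite in_itv/= lexx ltW.
have [d d0 hd] := within_continuous_mdist cg bab e20.
case/lastP: l abl hl => [/itv_partition_nil /eqP|l z [+ /eqP]];
  first by rewrite lt_eqF.
rewrite last_rcons rcons_path => /andP[pl lz] zb; subst z.
set x := last a l in lz; rewrite -cats1 (@mvariation_cat _ _ _ _ x)// => hl.
have axl : itv_partition a x l by split => //=.
have ax := itv_partition_le axl.
exists (Num.max x (b - d)); split.
- by rewrite le_max ax.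
- by rewrite gt_max lz ltrBlDr ltrDl.
move=> t; rewrite gt_max => /andP[xt bdt] tb.
have at_ : a <= t by rewrite (le_trans ax)// ltW.
have := hd t; rewrite in_itv/= at_ (ltW tb) => /(_ isT).
rewrite gtr0_norm ?subr_gt0// ltrBlDr -ltrBlDl bdt => /(_ isT) hbt.
have hta : mvariation a t gamma (l ++ [:: t]) <= fine (curve_length a t gamma).
  have rat := rectifiable_curve_sub rg (lexx _) at_ (ltW tb).
  rewrite -lee_fin -rectifiable_curve_lengthE//; apply: curve_length_ub.
  by rewrite cats1; split; rewrite ?rcons_path ?last_rcons// pl.
move: hl hta; rewrite (fine_curve_lengthD rg at_ (ltW tb)) (@mvariation_cat _ _ _ _ x)//.
rewrite !mvariation_cons !mvariation_nil.
have := metric_triangle (gamma x) (gamma t) (gamma b).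
rewrite (metric_sym (gamma t)); lra.
Qed.

(** An intermediate value argument: [t] is the supremum of the times reached with length at most
    [s]. Smallness of the length just before [t] gives one inequality; smallness just after [t],
    where the length already exceeds [s], gives the other. *)
Lemma curve_length_surj a b gamma s : rectifiable_curve a b gamma ->
  0 <= s -> s <= fine (curve_length a b gamma) ->
  exists2 t, t \in `[a, b] & curve_length a t gamma = s%:E.
Proof.
move=> rg s0 sl; have ab : a <= b by case: rg.
pose S := [set t | t \in `[a, b] /\ fine (curve_length a t gamma) <= s].
have Sa : S a by split; rewrite ?in_itv/= ?lexx// curve_length_xx.
have ubS : ubound S b by move=> t [+ _]; rewrite in_itv/= => /andP[].
have hsS : has_sup S by split; [exists a|exists b].
set t := sup S.
have at_ : a <= t by apply: ub_le_sup => //; exists b.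
have tb : t <= b by apply: ge_sup => //; exists a.
exists t; first by rewrite in_itv/= at_ tb.
have rat := rectifiable_curve_sub rg (lexx _) at_ tb.
rewrite rectifiable_curve_lengthE//; congr EFin.
apply/eqP; rewrite eq_le; apply/andP; split; apply/ler_addgt0Pl => e e0.
  move: at_ rat; rewrite le_eqVlt => /predU1P[<-|at_ rat].
    by rewrite curve_length_xx/= addr_ge0// ltW.
  have [y [ay yt hy]] := curve_length_small_left rat at_ e0.
  have yt0 : 0 < t - y by rewrite subr_gt0.
  have [t' [t'ab ht'] +] := sup_adherent yt0 hsS.
  rewrite -/t opprB addrC subrK => yt'.
  have t't : t' <= t by apply: ub_le_sup; [exists b|split].
  have at' : a <= t' by move: t'ab; rewrite in_itv/= => /andP[].
  rewrite (fine_curve_lengthD rat at' t't) addrC lerD//.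
  move: t't; rewrite le_eqVlt => /predU1P[<-|t't]; last exact: hy.
  by rewrite curve_length_xx ltW.
move: tb; rewrite le_eqVlt => /predU1P[tb|tb].
  by rewrite tb (le_trans sl)// lerDr ltW.
have rtb := rectifiable_curve_sub rg at_ (ltW tb) (lexx _).
have [y [ty yb hy]] := curve_length_small_right rtb tb e0.
pose t' := (t + y) / 2.
have [tt' t'y] : t < t' /\ t' < y by split; rewrite midf_lt.
have t'b : t' <= b by rewrite (le_trans (ltW t'y)).
have at' : a <= t' by rewrite (le_trans at_)// ltW.
have rat' := rectifiable_curve_sub rg (lexx _) at' t'b.
have : s < fine (curve_length a t' gamma).
  rewrite ltNge; apply/negP => ht'.
  suff : t' <= t by rewrite leNgt tt'.
  by apply: ub_le_sup; [exists b|split => //; rewrite in_itv/= at' t'b].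
move=> /ltW /le_trans; apply.
rewrite (fine_curve_lengthD rat' at_ (ltW tt')) addrC lerD//.
exact: hy.
Qed.

(** Distances are bounded by lengths of subcurves, measured from either end. These two bounds are
    all that is used later about the points [arc_param] returns. *)
Lemma arc_paramP a b gamma s : rectifiable_curve a b gamma ->
  0 <= s -> s <= fine (curve_length a b gamma) ->
  mdist (gamma a) (arc_param a b gamma s) <= s /\
  mdist (arc_param a b gamma s) (gamma b) <= fine (curve_length a b gamma) - s.
Proof.
move=> rg s0 sl; rewrite /arc_param.
case: xgetP => [t _ [tab tE]|]; last first.
  by have [t tab tE] := curve_length_surj rg s0 sl; move=> /(_ t) [].
move: (tab); rewrite in_itv/= => /andP[at_ tb].
have rat := rectifiable_curve_sub rg (lexx _) at_ tb.
have rtb := rectifiable_curve_sub rg at_ tb (lexx _).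
have := mdist_le_fine rat; have := mdist_le_fine rtb.
by rewrite (fine_curve_lengthD rg at_ tb) tE/= [_ - _]addrC addKr.
Qed.

End arc_length.

(** * Cutoffs and their upper gradients *)

Section integral_ge0.
Context d (T : measurableType d) (R : realType) (mu : {measure set T -> \bar R}).
Local Open Scope ereal_scope.

(* No measurability is required: the integral of a nonnegative function is a
   supremum over the simple functions below it. *)
Lemma ge0_subset_le_integral (A B : set T) (f g : T -> \bar R) :
  A `<=` B -> (forall x, A x -> 0 <= f x) -> (forall x, B x -> 0 <= g x) ->
  (forall x, A x -> f x <= g x) ->
  \int[mu]_(x in A) f x <= \int[mu]_(x in B) g x.
Proof.
move=> AB f0 g0 fg; rewrite !ge0_integralE//.
apply: le_ereal_sup => _ [h /= hf <-]; exists h => //= x.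
apply: le_trans (hf x) _; rewrite /patch.
have [xA|_] := boolP (x \in A).
  have Ax := set_mem xA.
  by rewrite (mem_set (AB _ Ax)) fg.
by case: ifPn => // /set_mem; exact: g0.
Qed.

End integral_ge0.

Section cutoff.
Context {R : realType} {d : measure_display} {X : borelMetricType R d}.

Lemma borel_open (A : set X) : open A -> measurable A.
Proof. by move=> oA; rewrite measurable_borel; apply: sub_sigma_algebra. Qed.

Lemma borel_ball (x : X) (r : R) : measurable (ball x r).
Proof.
apply: borel_open; rewrite ballEmdist openE => y /= yr.
apply/nbhs_ballP; exists (r - mdist x y) => /=; first by rewrite subr_gt0.
move=> z; rewrite ballEmdist/= => yz.
by rewrite (le_lt_trans (metric_triangle x y z))// -ltrBrDl.
Qed.

Lemma lipschitz_measurable (u : X -> R) (L : R) :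
  (forall x y, `|u x - u y| <= L * mdist x y) -> measurable_fun setT u.
Proof.
move=> uL.
have cu : continuous u.
  move=> x; apply/cvgrPdist_lt => e e0.
  have L1 : 0 < `|L| + 1 by rewrite ltr_wpDl.
  apply/nbhs_ballP; exists (e / (`|L| + 1)) => /=; first by rewrite divr_gt0.
  move=> y; rewrite ballEmdist/= ltr_pdivlMr// => xy.
  apply: le_lt_trans xy; apply: (le_trans (uL x y)).
  rewrite mulrC ler_wpM2l ?mdist_ge0//.
  by rewrite (le_trans (ler_norm L))// lerDl.
apply: (measurability _ (RGenOInfty.measurableE R)) => //.
move=> _ [_ [x ->] <-]; rewrite setTI; apply: borel_open.
by move/continuousP : cu; apply; rewrite set_itvE; exact: open_gt.
Qed.

(** Comparison with the constant [L] on the interval from [s] to [t]. As [g] along the curve need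
    not be measurable here, the comparison goes through [ge0_subset_le_integral]. *)
Lemma line_integral_lb (a b : R) (gamma : R -> X) (g : X -> \bar R) (L s t : R) :
  rectifiable_curve a b gamma -> (forall x, (0 <= g x)%E) -> 0 <= L ->
  0 <= s -> s <= t -> t <= fine (curve_length a b gamma) ->
  (forall z, s < z -> z < t -> (L%:E <= g (arc_param a b gamma z))%E) ->
  ((L * (t - s))%:E <= line_integral a b gamma g)%E.
Proof.
move=> rg g0 L0 s0 st tl Lg; rewrite /line_integral.
apply: (@le_trans _ _ (\int[lebesgue_measure]_(z in `]s, t[) cst L%:E z)%E).
  rewrite integral_cst//= lebesgue_measure_itv/= lte_fin.
  move: st; rewrite le_eqVlt => /predU1P[->|st]; first by rewrite ltxx subrr mulr0 mule0.
  by rewrite st.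
apply: ge0_subset_le_integral => [z|z _|z _|z] /=.
- by rewrite !in_itv/= => /andP[sz zt]; rewrite (le_trans s0 (ltW sz)) (le_trans (ltW zt)).
- by rewrite lee_fin.
- exact: g0.
- by rewrite in_itv/= => /andP[]; exact: Lg.
Qed.

(* Only the part of the curve where [u] exceeds its smaller endpoint value is
   used: it lies in [U] and has length at least the oscillation divided by [L]. *)
Lemma lipschitz_upper_gradient (u : X -> R) (U : set X) (L : R) :
  measurable U -> 0 < L -> (forall x, 0 <= u x) -> (forall x, ~ U x -> u x = 0) ->
  (forall x y, `|u x - u y| <= L * mdist x y) ->
  upper_gradient u (fun x => (L * \1_U x)%:E).
Proof.
move=> mU L0 u0 uU uL.
have g0 z : (0 <= (L * \1_U z)%:E)%E by rewrite lee_fin mulr_ge0// ltW.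
have uUP z : 0 < u z -> (L%:E <= (L * \1_U z)%:E)%E.
  move=> uz; rewrite indicE mem_set ?mulr1//.
  by apply: contrapT => /uU uz0; rewrite uz0 ltxx in uz.
split => //.
  by apply/measurable_EFinP; apply: measurable_funM => //; exact: measurable_indic.
move=> x y a b gamma rg <- <-; set l := fine (curve_length a b gamma).
have abl : `|u (gamma a) - u (gamma b)| / L <= l.
  rewrite ler_pdivrMr// mulrC (le_trans (uL _ _))// ler_pM2l//.
  exact: mdist_le_fine.
(* [c] is the arc length that is spent at least on the oscillation of [u] between the endpoints. *)
set c := _ / L in abl.
have cE : `|u (gamma a) - u (gamma b)| = L * c by rewrite /c mulrC divfK// gt_eqF.
have c0 : 0 <= c by rewrite divr_ge0// ltW.
(* Within length [c] of the endpoint with the larger value, [u] stays above the smaller, nonnegative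
   one, so it is positive there. The interval of length [c] is taken at the start of the curve in
   the first case and at its end in the second. *)
have [ba|ab] := leP (u (gamma b)) (u (gamma a)).
  rewrite cE -[c in (L * c)%:E]subr0; apply: line_integral_lb => //; first exact: ltW.
  move=> z z0 zc; apply: uUP.
  have [h _] := arc_paramP rg (ltW z0) (le_trans (ltW zc) abl).
  have := uL (gamma a) (arc_param a b gamma z) => /(le_trans (ler_norm _)).
  have := ler_wpM2l (ltW L0) h; have := u0 (gamma b).
  have : L * z < L * c by rewrite ltr_pM2l.
  rewrite -cE ger0_norm ?subr_ge0//; lra.
have -> : `|u (gamma a) - u (gamma b)|%:E = (L * (l - (l - c)))%:E.
  by rewrite cE opprB addrC subrK.
apply: line_integral_lb => //; [exact: ltW|by rewrite subr_ge0|by rewrite gerBl|].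
move=> z z0 zc; apply: uUP.
have z0' : 0 <= z by rewrite (le_trans _ (ltW z0))// subr_ge0.
have [_ h] := arc_paramP rg z0' (ltW zc).
have := uL (gamma b) (arc_param a b gamma z) => /(le_trans (ler_norm _)).
rewrite metric_sym.
have := ler_wpM2l (ltW L0) h; have := u0 (gamma a).
have : L * (l - z) < L * c by rewrite ltr_pM2l// ltrBlDl -ltrBlDr.
rewrite -cE ltr0_norm ?subr_lt0// -/l; lra.
Qed.

End cutoff.

(** * Averages over balls and a Jensen inequality *)

Section mms.
Context {R : realType} {d : measure_display} {X : borelMetricType R d}.
Variable mu : {measure set X -> \bar R}.
Hypothesis mms : metric_measure_space mu.

Lemma ball_measureE (x : X) (r : R) : 0 < r -> mu (ball x r) = (fine (mu (ball x r)))%:E.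
Proof. by move=> /(mms x)/andP[_ h]; rewrite fineK// ge0_fin_numE. Qed.

Lemma ball_measure_gt0 (x : X) (r : R) : 0 < r -> 0 < fine (mu (ball x r)).
Proof.
by move=> r0; rewrite -lte_fin -ball_measureE//; have /andP[] := mms x r0.
Qed.

Lemma averageE (x : X) (r : R) f : 0 < r ->
  average mu (ball x r) f =
  (((fine (mu (ball x r)))^-1)%R%:E * \int[mu]_(y in ball x r) f y)%E.
Proof.
by move=> r0; rewrite /average {1}ball_measureE// inver// gt_eqF// ball_measure_gt0.
Qed.

Lemma average_ge0 (x : X) (r : R) f : 0 < r -> (forall y, (0 <= f y)%E) ->
  (0 <= average mu (ball x r) f)%E.
Proof.
move=> r0 f0; rewrite averageE// mule_ge0//; by apply: integral_ge0 => y _; exact: f0.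
Qed.

(** Jensen with a harmless factor 2: the pointwise bound [h <= s + s * (s]^ q)^-1 * h [^ q] is
    averaged, and its last term contributes at most [s] as soon as the average of [h]^
    q[is at most]s [^ q]. *)
Lemma average_le_powR (x : X) (r q : R) (h : X -> R) : 0 < r -> 1 <= q ->
  measurable_fun setT h -> (forall y, 0 <= h y) ->
  (average mu (ball x r) (EFin \o h) <=
   2%:E * (average mu (ball x r) (fun y => (h y `^ q)%:E)) `^ q^-1)%E.
Proof.
move=> r0 q1 mh h0; have q0 : 0 < q by rewrite (lt_le_trans _ q1).
have m0 := ball_measure_gt0 x r0.
have mhq : measurable_fun (ball x r) (fun y => (h y `^ q)%:E).
  apply/measurable_EFinP; apply: measurable_funTS.
  exact: (measurableT_comp (measurable_powR q)).
have Aq0 : (0 <= average mu (ball x r) (fun y => (h y `^ q)%:E))%E.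
  by apply: average_ge0 => // y; rewrite lee_fin powR_ge0.
set A := average _ _ (fun y => (h y `^ q)%:E) in Aq0 *.
have key s : 0 < s -> (A <= (s `^ q)%:E)%E ->
    (average mu (ball x r) (EFin \o h) <= (2 * s)%:E)%E.
  move=> s0 As.
  (* If [h y > s] then [h y / s <= (h y / s)^q]. *)
  have hs y : h y <= s + s * (s `^ q)^-1 * h y `^ q.
    have [hys|shy] := leP (h y) s.
      rewrite (le_trans hys)// lerDl mulr_ge0 ?powR_ge0//.
      by rewrite mulr_ge0 ?invr_ge0 ?powR_ge0 ?ltW.
    rewrite ler_wpDl//; first exact: ltW.
    rewrite -mulrA mulrC -ler_pdivrMr// mulrC.
    rewrite [X in _ <= X](_ : _ = (s^-1 * h y) `^ q).
      by apply: le1r_powR => //; rewrite ler_pdivlMl// mulr1 ltW.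
    by rewrite powRM// ?invr_ge0 ?(ltW s0)// -powRN -mulN1r powRrM powR_inv1// ltW.
  rewrite averageE//.
  apply: (@le_trans _ _ (((fine (mu (ball x r)))^-1)%R%:E *
      (s%:E * mu (ball x r) + (s * (s `^ q)^-1)%:E * \int[mu]_(y in ball x r) (h y `^ q)%:E)))%E.
    apply: lee_wpmul2l; first by rewrite lee_fin invr_ge0 ltW.
    have k0 : 0 <= s * (s `^ q)^-1 by rewrite mulr_ge0 ?invr_ge0 ?powR_ge0// ltW.
    rewrite -ge0_integralZl_EFin//; last 2 first.
    - exact: borel_ball.
    - by move=> y _; rewrite lee_fin powR_ge0.
    rewrite -integral_cst//; last exact: borel_ball.
    rewrite -ge0_integralD//; last 4 first.
    - exact: borel_ball.
    - by move=> y _; rewrite lee_fin ltW.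
    - by move=> y _; rewrite -EFinM lee_fin mulr_ge0// powR_ge0.
    - by apply: measurable_funeM.
    apply: ge0_subset_le_integral => // y _ /=; rewrite -?EFinM -?EFinD lee_fin//.
    by rewrite addr_ge0 ?(ltW s0)// mulr_ge0// powR_ge0.
  rewrite ge0_muleDr ?mule_ge0 ?integral_ge0//=; last 3 first.
  - by rewrite lee_fin ltW.
  - by rewrite lee_fin mulr_ge0 ?invr_ge0 ?powR_ge0 ?(ltW s0).
  - by move=> y _; rewrite lee_fin powR_ge0.
  rewrite (muleCA _ (s * _)%:E) -averageE// -/A.
  rewrite {2}ball_measureE// -!EFinM mulrCA mulVf ?gt_eqF// mulr1.
  rewrite mulr2n mulrDl mul1r EFinD leeD2l//.
  apply: (@le_trans _ _ ((s * (s `^ q)^-1)%:E * (s `^ q)%:E)%E).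
    by apply: lee_wpmul2l => //; rewrite lee_fin mulr_ge0 ?invr_ge0 ?powR_ge0 ?(ltW s0).
  by rewrite -EFinM divfK// gt_eqF// powR_gt0.
have [Ay|Afin] := eqVneq A +oo%E.
  by rewrite Ay poweRyr ?invr_eq0 ?gt_eqF// gt0_muley ?leey// lte_fin.
have {Afin} [a a0 AE] : exists2 a, 0 <= a & A = a%:E.
  by exists (fine A); [exact: fine_ge0|rewrite fineK// ge0_fin_numE// ltey].
rewrite AE poweR_EFin -EFinM; apply/lee_addgt0Pr => e e0.
have e20 : 0 < e / 2 by rewrite divr_gt0.
have sp : 0 < a `^ q^-1 + e / 2 by rewrite ltr_wpDl ?powR_ge0.
rewrite -EFinD [X in (_ <= X%:E)%E](_ : _ = 2 * (a `^ q^-1 + e / 2)); last by lra.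
have aE : a = (a `^ q^-1) `^ q by rewrite -powRrM mulVf ?gt_eqF// powRr1.
apply: key => //; rewrite AE lee_fin {1}aE.
apply: ge0_ler_powR; rewrite ?nnegrE ?powR_ge0 ?(ltW sp) ?(ltW q0)//.
by rewrite lerDl ltW.
Qed.

End mms.

(** * Sobolev-Poincare inequalities imply doubling *)

Section de_giorgi.
Context {R : realType}.
Implicit Types (a : nat -> R) (p q K : R).

(** With [b j = a j]^ q^-1[and]1 + e = q / p[the recursion reads]b j.+1 <= K * 2 ^+ j * b j
    [^ (1 + e)]. If [b 0] is small, the superlinear power beats the factor [2 ^+ j] and [b] decays
    geometrically, against the lower bound [m]. *)
Lemma de_giorgi_iteration p q K : 0 < p -> p < q -> 1 <= K ->
  exists2 c : R, 0 < c <= 2^-1 &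
    forall a (m : R), 0 < m -> (forall j, m <= a j) -> a 0%N < c ->
      (forall j, a j <= a 0%N) ->
      (forall j, a j <= 2^-1 -> a j.+1 `^ q^-1 <= K * 2 ^+ j * a j `^ p^-1) -> False.
Proof.
move=> p0 pq K1; have q0 : 0 < q by rewrite (lt_trans p0).
pose e := q / p - 1.
have e0 : 0 < e by rewrite subr_gt0 ltr_pdivlMr// mul1r.
have K0 : 0 < K by rewrite (lt_le_trans _ K1).
have h0 : 0 < 2^-1 :> R by [].
pose eta : R := 2^-1 `^ e^-1.
have eta0 : 0 < eta by rewrite powR_gt0.
have etaE : eta `^ e = 2^-1 by rewrite -powRrM mulVf ?gt_eqF// powRr1.
have eta1 : eta < 1.
  rewrite ltNge; apply/negP => h.
  have : 1 `^ e <= eta `^ e by apply: ge0_ler_powR; rewrite ?nnegrE ?(ltW e0) ?(ltW eta0).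
  rewrite etaE powR1; lra.
pose b0 := (eta / K) `^ e^-1.
have b00 : 0 < b0 by rewrite powR_gt0// divr_gt0.
(* The bound by one half keeps every [a j] in the range where the recursion is assumed. *)
exists (Num.min 2^-1 (b0 `^ q)).
  by rewrite lt_min h0 powR_gt0// ge_min lexx.
move=> a m m0 ma; rewrite lt_min => /andP[a02 a0b] aa0 step.
have a_gt0 j : 0 < a j by rewrite (lt_le_trans m0).
pose b j := a j `^ q^-1.
have b_gt0 j : 0 < b j by rewrite powR_gt0.
have bb0 : b 0%N < b0.
  have -> : b0 = (b0 `^ q) `^ q^-1 by rewrite -powRrM divff ?gt_eqF// powRr1// ltW.
  by apply: gt0_ltr_powR; rewrite ?nnegrE ?invr_gt0 ?powR_ge0// ltW.
have bstep j : b j.+1 <= K * 2 ^+ j * (b j * b j `^ e).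
  apply: (le_trans (step j _)); first by rewrite (le_trans (aa0 j))// ltW.
  rewrite ler_wpM2l ?mulr_ge0 ?exprn_ge0 ?(ltW K0)//.
  rewrite (@mulr_powRB1 _ (b j) (q / p)); [|exact/ltW/b_gt0|exact: divr_gt0].
  by rewrite -powRrM mulrA mulVf ?gt_eqF// mul1r.
have bj j : b j <= b 0%N * eta ^+ j.
  elim: j => [|j ih]; first by rewrite mulr1.
  apply: (le_trans (bstep j)).
  have h1 : b j `^ e <= (b 0%N) `^ e * 2^-1 ^+ j.
    have -> : (2^-1 : R) ^+ j = (eta ^+ j) `^ e.
      rewrite -(@powR_mulrn _ eta j) ?(ltW eta0)// powRAC etaE.
      by rewrite powR_mulrn// ltW.
    rewrite -powRM ?(ltW (b_gt0 _)) ?exprn_ge0 ?(ltW eta0)//.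
    apply: ge0_ler_powR; rewrite ?nnegrE ?(ltW e0) ?(ltW (b_gt0 _))//.
    by rewrite mulr_ge0 ?exprn_ge0 ?(ltW eta0) ?(ltW (b_gt0 _)).
  have h2 : b 0%N `^ e <= eta / K.
    have -> : eta / K = b0 `^ e by rewrite -powRrM mulVf ?gt_eqF// powRr1// divr_ge0 ?ltW.
    by apply: ge0_ler_powR; rewrite ?nnegrE ?(ltW e0) ?(ltW b00) ?(ltW (b_gt0 _)) ?(ltW bb0).
  apply: (@le_trans _ _ (K * 2 ^+ j * (b 0%N * eta ^+ j * (eta / K * 2^-1 ^+ j)))).
    rewrite ler_wpM2l ?mulr_ge0 ?exprn_ge0 ?(ltW K0)//.
    apply: ler_pM; rewrite ?powR_ge0 ?(ltW (b_gt0 _))//.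
    by rewrite (le_trans h1)// ler_wpM2r// exprn_ge0.
  have := expf_neq0 j (lt0r_neq0 (ltr0n R 2)); have := lt0r_neq0 K0.
  rewrite exprS exprVn; move: (2 ^+ j) (eta ^+ j) => t s Kn0 tn0.
  by rewrite le_eqVlt; apply/orP; left; apply/eqP; field; rewrite Kn0 tn0.
have : (fun j => b 0%N * eta ^+ j) @ \oo --> (b 0%N * 0 : R).
  by apply: cvgMr; apply: cvg_expr; rewrite gtr0_norm.
rewrite mulr0 => /cvgrPdist_lt /(_ (m `^ q^-1)); rewrite powR_gt0// => /(_ isT)[N _ /(_ N)] /=.
rewrite leqnn => /(_ isT); rewrite sub0r normrN gtr0_norm ?mulr_gt0 ?exprn_gt0//.
apply/negP; rewrite -leNgt (le_trans _ (bj N))//.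
apply: ge0_ler_powR => //; rewrite ?nnegrE; [|exact: ltW..].
by rewrite invr_ge0 ltW.
Qed.

End de_giorgi.

Lemma le_poweR {R : realType} (r : R) (a b : \bar R) :
  0 <= r -> (0 <= a)%E -> (a <= b)%E -> (a `^ r <= b `^ r)%E.
Proof.
move=> r0 a0 ab; apply: gt0_ler_poweR => //; rewrite in_itv/= leey andbT//.
exact: le_trans ab.
Qed.

(** Brings the Sobolev inequality of a cutoff down to real numbers: [A] is the average of the
    deviation to the power [q], at least 1/2 on a set of relative measure [a]; [B] is the average of
    the gradient to the power [p], where the gradient is [L] on a set of relative measure at most
    [b]. *)
Lemma powR_le_of_poweR_le {R : realType} (p q K L a b : R) (A B : \bar R) :
  0 <= K -> 0 < p -> 0 < q -> 0 <= a -> 0 <= b -> 0 < L ->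
  ((a * 2^-1 `^ q)%:E <= A)%E -> (0 <= B)%E -> (B <= (L `^ p * b)%:E)%E ->
  (A `^ q^-1 <= K%:E * B `^ p^-1)%E -> a `^ q^-1 <= 2 * K * L * b `^ p^-1.
Proof.
move=> K0 p0 q0 a0 b0 L0 aA B0 Bb AB.
have h20 : 0 <= 2^-1 :> R by rewrite invr_ge0.
have q10 : 0 <= q^-1 by rewrite invr_ge0 ltW.
have p10 : 0 <= p^-1 by rewrite invr_ge0 ltW.
have a20 : (0 <= (a * 2^-1 `^ q)%:E)%E by rewrite lee_fin mulr_ge0// powR_ge0.
have h1 := le_poweR q10 a20 aA; have h2 := le_poweR p10 B0 Bb.
have K0' : (0 <= K%:E)%E by rewrite lee_fin.
have := le_trans h1 (le_trans AB (lee_wpmul2l K0' h2)).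
rewrite !poweR_EFin -EFinM lee_fin !powRM ?powR_ge0// -!powRrM.
rewrite !mulfV ?gt_eqF// !powRr1//; last exact: ltW.
by rewrite ler_pdivrMr// mulrC !mulrA => /le_trans; apply; rewrite mulrAC.
Qed.

Section sobolev_doubling.
Context {R : realType} {d : measure_display} {X : borelMetricType R d}.
Variable mu : {measure set X -> \bar R}.
Hypothesis mms : metric_measure_space mu.

Lemma ball_measure_le (x y : X) (r s : R) : 0 < r -> 0 < s ->
  ball x r `<=` ball y s -> fine (mu (ball x r)) <= fine (mu (ball y s)).
Proof.
move=> r0 s0 xy; rewrite -lee_fin -!(ball_measureE mms)//.
by apply: le_measure => //; rewrite inE; exact: borel_ball.
Qed.

Lemma ball_integrable_bounded (x : X) (r M : R) (u : X -> R) : 0 < r ->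
  measurable_fun setT u -> (forall y, `|u y| <= M) ->
  mu.-integrable (ball x r) (EFin \o u).
Proof.
move=> r0 mu_ uM.
apply: (@le_integrable _ _ _ mu _ _ _ (cst M%:E)) => //.
- exact: borel_ball.
- by apply/measurable_EFinP; exact: measurable_funTS.
- move=> y _; rewrite /= lee_fin (le_trans (uM y))// ger0_norm//.
  by rewrite (le_trans _ (uM y)).
apply/integrableP; split; first exact: measurable_cst.
rewrite integral_cst; last exact: borel_ball.
by rewrite ball_measureE// -EFinM ltry.
Qed.

Definition cutoff (x : X) (s t : R) (y : X) : R :=
  Num.max 0 (Num.min 1 ((t - mdist x y) / (t - s))).

Lemma cutoff_ge0 x s t y : 0 <= cutoff x s t y.
Proof. by rewrite /cutoff le_max lexx. Qed.

Lemma cutoff_le1 x s t y : cutoff x s t y <= 1.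
Proof. by rewrite /cutoff ge_max ler01 ge_min lexx. Qed.

Lemma cutoff_out x s t y : s < t -> ~ ball x t y -> cutoff x s t y = 0.
Proof.
rewrite ballEmdist/= => st /negP; rewrite -leNgt => txy; apply/max_idPl.
rewrite ge_min; apply/orP; right.
by rewrite pmulr_lle0 ?subr_le0// invr_gt0 subr_gt0.
Qed.

Lemma cutoff_in x s t y : s < t -> ball x s y -> cutoff x s t y = 1.
Proof.
rewrite ballEmdist/= => st xys; rewrite /cutoff.
suff /min_idPl -> : 1 <= (t - mdist x y) / (t - s) by apply/max_idPr.
by rewrite ler_pdivlMr ?subr_gt0// mul1r lerD2l lerN2 ltW.
Qed.

Lemma cutoff_lipschitz x s t y z : s < t ->
  `|cutoff x s t y - cutoff x s t z| <= (t - s)^-1 * mdist y z.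
Proof.
move=> st; have ts : 0 < (t - s)^-1 by rewrite invr_gt0 subr_gt0.
have clip (a b : R) : `|Num.max 0 (Num.min 1 a) - Num.max 0 (Num.min 1 b)| <= `|a - b|.
  rewrite !maxEle !minEle ler_norml.
  have [h|h] := leP 0 (a - b);
    [rewrite (ger0_norm h)|rewrite (ltr0_norm h)]; apply/andP; split;
    do !case: ifPn; rewrite -?ltNge; move=> *; lra.
apply: (le_trans (clip _ _)); rewrite -mulrBl normrM (gtr0_norm ts) mulrC.
rewrite ler_pM2l// opprB addrC addrA subrK ler_norml.
have := metric_triangle x y z; have := metric_triangle x z y.
by rewrite (metric_sym z y) => ? ?; apply/andP; split; lra.
Qed.

Lemma cutoff_L1loc (x : X) (s t : R) : s < t -> L1loc mu (cutoff x s t).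
Proof.
move=> st; have mc : measurable_fun setT (cutoff x s t).
  by apply: (@lipschitz_measurable _ _ _ _ (t - s)^-1) => y z; exact: cutoff_lipschitz.
split => // y r r0; apply: (@ball_integrable_bounded _ _ 1) => // z.
by rewrite ger0_norm ?cutoff_ge0// cutoff_le1.
Qed.

Lemma cutoff_upper_gradient (x : X) (s t : R) : s < t ->
  upper_gradient (cutoff x s t) (fun y => ((t - s)^-1 * \1_(ball x t) y)%:E).
Proof.
move=> st; apply: lipschitz_upper_gradient.
- exact: borel_ball.
- by rewrite invr_gt0 subr_gt0.
- exact: cutoff_ge0.
- by move=> y; exact: cutoff_out.
- by move=> y z; exact: cutoff_lipschitz.
Qed.

Lemma raverage_cutoff_le (x : X) (s t r : R) : 0 < t -> s < t -> t <= r ->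
  raverage mu (ball x r) (cutoff x s t) <=
  fine (mu (ball x t)) / fine (mu (ball x r)).
Proof.
move=> t0 st tr; have r0 := lt_le_trans t0 tr.
rewrite /raverage; set A := average _ _ _.
have A0 : (0 <= A)%E by apply: average_ge0 => // y; rewrite lee_fin cutoff_ge0.
suff : (A <= (fine (mu (ball x t)) / fine (mu (ball x r)))%:E)%E.
  by case: A A0 => [a| |].
rewrite /A averageE// mulrC EFinM; apply: lee_wpmul2l.
  by rewrite lee_fin invr_ge0 ltW// ball_measure_gt0.
apply: (@le_trans _ _ (\int[mu]_(y in ball x r) (\1_(ball x t) y)%:E)%E).
  apply: ge0_subset_le_integral => // y _ /=; rewrite lee_fin ?cutoff_ge0//.
  rewrite indicE; have [|/negP] := boolP (y \in (ball x t : set X)); first by rewrite cutoff_le1.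
  by rewrite inE => h; rewrite cutoff_out.
rewrite integral_indic; [|exact: borel_ball..].
rewrite -(ball_measureE mms)//; apply: le_measure; rewrite ?inE//; last exact: borel_ball.
by apply: measurableI; exact: borel_ball.
Qed.

Section self_improvement_doubling.
Variables (p q CP sigma : R).
Hypotheses (p1 : 1 <= p) (pq : p < q) (CP1 : 1 <= CP) (sigma1 : 1 <= sigma).
Hypothesis sobolev : forall (x : X) (r : R) (u : X -> R) (g : X -> \bar R),
  0 < r -> L1loc mu u -> upper_gradient u g ->
  ((average mu (ball x r)
      (fun y => (`|u y - raverage mu (ball x r) u| `^ q)%:E)) `^ q^-1 <=
   (CP * r)%:E *
     (average mu (ball x (sigma * r)) (fun y => g y `^ p)) `^ p^-1)%E.

(* The cutoff is 1 on the small ball while its average is at most [a t <= 1/2], so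
   it deviates from its average by at least 1/2 there. *)
Lemma sobolev_cutoff (x : X) (s t r : R) : 0 < s -> s < t -> t <= r ->
  let a z := fine (mu (ball x z)) / fine (mu (ball x r)) in
  a t <= 2^-1 -> a s `^ q^-1 <= 2 * (CP * r) / (t - s) * a t `^ p^-1.
Proof.
move=> s0 st tr a at2.
have t0 := lt_trans s0 st; have r0 := lt_le_trans t0 tr.
have sr := lt_le_trans st tr.
have p0 : 0 < p by rewrite (lt_le_trans _ p1).
have q0 : 0 < q by rewrite (lt_trans p0).
have sgr0 : 0 < sigma * r by rewrite mulr_gt0// (lt_le_trans _ sigma1).
have := ball_measure_gt0 mms x s0; have := ball_measure_gt0 mms x t0.
have := ball_measure_gt0 mms x r0; have := ball_measure_gt0 mms x sgr0.
move=> msg0 mr0 mt0 ms0.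
have as0 : 0 <= a s by rewrite divr_ge0 ?ltW.
have at0 : 0 <= a t by rewrite divr_ge0 ?ltW.
have L0 : 0 < (t - s)^-1 by rewrite invr_gt0 subr_gt0.
have := sobolev x r0 (cutoff_L1loc x st) (cutoff_upper_gradient x st).
have := raverage_cutoff_le x t0 st tr; rewrite -/(a t).
set uB := raverage _ _ _ => uBa.
set A := average mu (ball x r) _; set B := average mu _ _ => AB.
have hA : ((a s * 2^-1 `^ q)%:E <= A)%E.
  rewrite /A averageE// (_ : a s * _ = (fine (mu (ball x r)))^-1 *
    (2^-1 `^ q * fine (mu (ball x s)))); last by rewrite /a; ring.
  rewrite EFinM; apply: lee_wpmul2l.
    by rewrite lee_fin invr_ge0 ltW.
  rewrite EFinM -(ball_measureE mms)// -integral_cst; last exact: borel_ball.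
  apply: ge0_subset_le_integral => [|y _|y _|y xsy] /=; rewrite ?lee_fin ?powR_ge0//.
    by apply: le_ball; exact: ltW.
  apply: ge0_ler_powR; rewrite ?nnegrE ?(ltW q0)//.
  rewrite cutoff_in//; apply: le_trans (ler_norm _).
  by move: (le_trans uBa at2); lra.
(* The gradient lives on [ball x t], and dividing by the measure of [ball x r] instead of that of
   the larger [ball x (sigma * r)] only increases the bound. *)
have hB : (B <= (((t - s)^-1) `^ p * a t)%:E)%E.
  rewrite /B averageE// (_ : _ * a t = (fine (mu (ball x r)))^-1 *
    (fine (mu (ball x t)) * (t - s)^-1 `^ p)); last by rewrite /a; ring.
  rewrite EFinM.
  apply: (@le_trans _ _ ((fine (mu (ball x (sigma * r))))^-1%R%:E *
    (fine (mu (ball x t)) * (t - s)^-1 `^ p)%:E)%E); last first.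
    rewrite -!EFinM lee_fin ler_wpM2r ?mulr_ge0 ?powR_ge0 ?(ltW mt0)//.
    rewrite lef_pV2 ?posrE//; apply: ball_measure_le => //.
    by apply: le_ball; rewrite ler_peMl// ltW.
  apply: lee_wpmul2l; first by rewrite lee_fin invr_ge0 ltW.
  rewrite [fine (mu (ball x t)) * _]mulrC EFinM.
  apply: (@le_trans _ _ (\int[mu]_(y in ball x (sigma * r))
     (((t - s)^-1 `^ p)%:E * (\1_(ball x t) y)%:E))%E).
    apply: ge0_subset_le_integral => [//|y _|y _|y _] /=.
    - by rewrite lee_fin powR_ge0.
    - by rewrite -EFinM lee_fin mulr_ge0 ?powR_ge0.
    rewrite -EFinM lee_fin indicE; case: (y \in _); rewrite ?mulr1//.
    by rewrite !mulr0 powR0// gt_eqF.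
  rewrite ge0_integralZl_EFin ?powR_ge0//.
  - rewrite integral_indic; [|exact: borel_ball..].
    apply: lee_wpmul2l; first by rewrite lee_fin powR_ge0.
    rewrite -(ball_measureE mms)//; apply: le_measure; rewrite ?inE//; last exact: borel_ball.
    by apply: measurableI; exact: borel_ball.
  - exact: borel_ball.
  - by apply/measurable_EFinP; apply: measurable_indic; exact: borel_ball.
have A0 : (0 <= A)%E by apply: average_ge0 => // y; rewrite lee_fin powR_ge0.
have B0 : (0 <= B)%E by apply: average_ge0 => // y; rewrite poweR_ge0.
have K0 : 0 <= CP * r by rewrite mulr_ge0 ?(ltW r0)// (le_trans _ CP1).
exact: (powR_le_of_poweR_le K0 p0 q0 as0 at0 L0 hA B0 hB AB).
Qed.

Lemma sobolev_doubling : doubling mu.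
Proof.
have p0 : 0 < p by rewrite (lt_le_trans _ p1).
(* [sobolev_cutoff] on the ball of radius [2 * r], with radii differing by [r * 2^-1 ^+ j.+2], has
   the factor [2 * (CP * (2 * r)) / (r * 2^-1 ^+ j.+2)], which is [16 * CP * 2 ^+ j]. *)
have [|c /andP[c0 c2] H] := @de_giorgi_iteration R p q (16 * CP) p0 pq.
  by rewrite (le_trans CP1)// ler_peMl ?(le_trans _ CP1)// ler1n.
(* Failure of doubling with constant [c^-1] on one ball says precisely that the initial ratio
   [a (rj 0)] is below the threshold [c]. *)
exists c^-1; first by rewrite invr_gt0.
move=> x r r0; have r20 : 0 < 2 * r by rewrite mulr_gt0.
rewrite (ball_measureE mms x r20) (ball_measureE mms x r0) -EFinM lee_fin ler_pdivlMl//.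
rewrite leNgt; apply/negP => hlt.
pose rj (j : nat) := r * (2^-1 + 2^-1 ^+ j.+1).
have hj (j : nat) : 0 < (2^-1 : R) ^+ j by rewrite exprn_gt0.
have rj0 j : 0 < rj j by rewrite mulr_gt0// addr_gt0.
have rj00 : rj 0%N = r by rewrite /rj expr1; lra.
have rjd j : rj j - rj j.+1 = r * 2^-1 ^+ j.+2.
  by rewrite /rj -mulrBr; congr (_ * _); rewrite (exprS _ j.+1); move: (2^-1 ^+ j.+1) => z; lra.
have rjlt j : rj j.+1 < rj j by rewrite -subr_gt0 rjd mulr_gt0.
have rjle j : rj j <= r.
  by elim: j => [|j]; [rewrite rj00|apply: le_trans; exact: ltW].
have rjge j : r / 2 <= rj j by rewrite ler_wpM2l ?(ltW r0)// lerDl ltW.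
have r2r : r <= 2 * r by rewrite ler_peMl ?ltW// ltr1n.
have m20 := ball_measure_gt0 mms x r20.
pose a z := fine (mu (ball x z)) / fine (mu (ball x (2 * r))).
have a_le z w : 0 < z -> z <= w -> a z <= a w.
  move=> z0 zw; rewrite ler_wpM2r ?invr_ge0 ?(ltW m20)//.
  by apply: ball_measure_le => //; [rewrite (lt_le_trans z0)|exact: le_ball].
apply: (H (fun j => a (rj j)) (a (r / 2))) => /=.
- by rewrite divr_gt0// ball_measure_gt0// divr_gt0.
- by move=> j; apply: a_le; rewrite ?divr_gt0.
- by rewrite rj00 ltr_pdivrMr.
- by move=> j; apply: a_le; rewrite ?rj00.
move=> j aj2.
apply: (le_trans (sobolev_cutoff (rj0 _) (rjlt j) (le_trans (rjle j) r2r) aj2)).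
rewrite -/(a _) le_eqVlt; apply/orP; left; apply/eqP; congr (_ * _).
rewrite rjd !exprS exprVn; have := expf_neq0 j (lt0r_neq0 (ltr0n R 2)).
move: (2 ^+ j) => z z0; field; rewrite z0 gt_eqF//=.
Qed.

End self_improvement_doubling.
End sobolev_doubling.

(** * Nets in doubling spaces *)

Section overlap.
Context d (T : measurableType d) (R : realType) (mu : {measure set T -> \bar R}).

(** Each integral is one over [F] of [f] cut off to [E c]; at a point [z] the sum of the cut-off
    functions is [f z] times the number of sets containing [z]. *)
Lemma integral_overlap (I : eqType) (l : seq I) (E : I -> set T) (F : set T)
    (f : T -> \bar R) (N : nat) :
  (forall c, measurable (E c)) -> measurable F -> measurable_fun setT f ->
  (forall z, (0 <= f z)%E) -> (forall c, c \in l -> E c `<=` F) ->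
  (forall z, (count (fun c => z \in E c) l <= N)%N) ->
  (\sum_(c <- l) \int[mu]_(z in E c) f z <= N%:R%:E * \int[mu]_(z in F) f z)%E.
Proof.
move=> mE mF mf f0 EF lN.
have mfE c : measurable_fun setT (f \_ (E c))
  by apply/(measurable_restrictT f (mE c)); exact: measurable_funTS.
have fE0 c z : (0 <= (f \_ (E c)) z)%E by rewrite /patch; case: ifP.
rewrite (eq_big_seq (fun c => \int[mu]_(z in F) (f \_ (E c)) z)%E); last first.
  by move=> c cl; rewrite -integral_mkcondr setIidr//; exact: EF.
rewrite -ge0_integral_sum//; last by move=> c; exact: measurable_funTS.
rewrite -ge0_integralZl_EFin//; last exact: measurable_funTS.
have fN z : (\sum_(c <- l) (f \_ (E c)) z = (count (fun c => z \in E c) l)%:R%:E * f z)%E.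
  elim: l {EF lN} => [|c l ih]; first by rewrite big_nil mul0e.
  rewrite big_cons ih /= natrD EFinD ge0_muleDl ?lee_fin//; congr (_ + _)%E.
  by rewrite /patch; case: ifP; rewrite ?mul1e ?mul0e.
apply: ge0_subset_le_integral => [//|z _|z _|z _].
- by rewrite fN mule_ge0// lee_fin.
- by rewrite mule_ge0// lee_fin.
- by rewrite fN lee_wpmul2r// lee_fin ler_nat.
Qed.

End overlap.

Section nets.
Context {R : realType} {d : measure_display} {X : borelMetricType R d}.
Variable mu : {measure set X -> \bar R}.
Hypothesis mms : metric_measure_space mu.
Variable D : R.
Hypothesis D1 : 1 <= D.
Hypothesis muD : forall (x : X) (r : R), 0 < r ->
  fine (mu (ball x (2 * r))) <= D * fine (mu (ball x r)).
Implicit Types (l : seq X) (x z c : X) (r s : R).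

Lemma doubling_iter k x r : 0 < r ->
  fine (mu (ball x (2 ^+ k * r))) <= D ^+ k * fine (mu (ball x r)).
Proof.
move=> r0; elim: k => [|k ih]; first by rewrite !expr0 !mul1r.
rewrite !exprS -!mulrA; apply: (le_trans (muD _ _)); first by rewrite mulr_gt0// exprn_gt0.
by rewrite ler_wpM2l// (le_trans _ D1).
Qed.

(** A finite [r]-separated set, as a list; for [r > 0] it has no repetitions. *)
Definition dispersed r l := pairwise (fun c z => r <= mdist c z) l.

Lemma dispersed_count1 r l z : dispersed r l ->
  (count (fun c => z \in (ball c (r / 2) : set X)) l <= 1)%N.
Proof.
move=> sl; rewrite -size_filter.
have : dispersed r [seq c <- l | z \in (ball c (r / 2) : set X)] by exact: pairwise_filter.
have : all (fun c => z \in (ball c (r / 2) : set X)) [seq c <- l | z \in (ball c (r / 2) : set X)].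
  exact: filter_all.
rewrite /dispersed; case: (seq.filter _ l) => [//|a [//|b s]] /= /and3P[+ + _] /andP[/andP[rab _] _].
rewrite !inE !ballEmdist/= => az bz.
have := metric_triangle a z b; rewrite (metric_sym z b); lra.
Qed.

(** Volume packing. The balls of radius [r / 2] around the points are disjoint and lie in
    [ball z (s + r / 2)], and each carries at least the fraction [(D ^+ k)^-1] of its measure:
    [4 * s + r <= 2 ^+ k * r] makes [ball c (2 ^+ k * (r / 2))] contain that ball. *)
Lemma dispersed_size r s l z k : 0 < r -> 0 <= s -> dispersed r l ->
  (forall c, c \in l -> mdist c z < s) -> 4 * s + r <= 2 ^+ k * r ->
  (size l)%:R <= D ^+ k.
Proof.
move=> r0 s0 sl lz sk.
have r20 : 0 < r / 2 by rewrite divr_gt0.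
have F0 : 0 < s + r / 2 by rewrite ltr_wpDl.
have mF0 := ball_measure_gt0 mms z F0.
set mF := fine _ in mF0.
have H : (\sum_(c <- l) \int[mu]_(y in ball c (r / 2)) cst 1 y <=
    1%:R%:E * \int[mu]_(y in ball z (s + r / 2)) cst 1 y)%E.
  apply: integral_overlap => //.
  - by move=> c; exact: borel_ball.
  - exact: borel_ball.
  - move=> c cl y; rewrite !ballEmdist/= => cy.
    have := metric_triangle z c y; have := lz _ cl; rewrite (metric_sym c z); lra.
  - by move=> y; exact: dispersed_count1.
have D0 : 0 < D ^+ k by rewrite exprn_gt0// (lt_le_trans _ D1).
have lowc c : c \in l -> (((mF / D ^+ k)%:E <= \int[mu]_(y in ball c (r / 2)) cst 1 y)%E).
  move=> cl; rewrite integral_cst ?mul1e; last exact: borel_ball.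
  rewrite (ball_measureE mms c r20) lee_fin ler_pdivrMr// mulrC.
  apply: le_trans (doubling_iter k c r20).
  apply: ball_measure_le => //; first by rewrite mulr_gt0// exprn_gt0.
  move=> y; rewrite !ballEmdist/= => zy.
  have := metric_triangle c z y; have := lz _ cl; rewrite mulrA; lra.
have : (\sum_(c <- l) (mF / D ^+ k)%:E <= mF%:E)%E.
  rewrite big_seq; apply: (@le_trans _ _ _ _ _ (lee_sum _ lowc)); rewrite -big_seq.
  apply: (le_trans H).
  by rewrite integral_cst ?mul1e; [rewrite (ball_measureE mms z F0)|exact: borel_ball].
rewrite sumEFin lee_fin big_const_seq count_predT iter_addr_0 -(mulr_natl (mF / _)) mulrCA.
by rewrite ger_pMr// ler_pdivrMr// mul1r.
Qed.

Lemma dispersed_overlap r s l z k : 0 < r -> 0 <= s -> dispersed r l ->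
  4 * s + r <= 2 ^+ k * r ->
  (count (fun c => z \in (ball c s : set X)) l)%:R <= D ^+ k.
Proof.
move=> r0 s0 sl sk; rewrite -size_filter.
apply: (@dispersed_size r s _ z k) => //; first exact: pairwise_filter.
by move=> c; rewrite mem_filter => /andP[]; rewrite inE ballEmdist.
Qed.

(** A separated list of maximal size is a net, since an uncovered point could be added to it. The
    maximum exists because [dispersed_size] bounds all sizes. *)
Lemma net_exists x r s : 0 < r -> 0 < s -> exists l, [/\ dispersed r l,
  (forall c, c \in l -> ball x s c) &
  (forall z, ball x s z -> exists2 c, c \in l & ball c r z)].
Proof.
move=> r0 s0.
have [k sk] : exists k, 4 * s + r <= 2 ^+ k * r.
  exists (Num.bound (4 * s / r + 1)).
  rewrite -ler_pdivrMr// mulrDl divff ?gt_eqF//.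
  by apply: ltW; exact: upper_nthrootP.
pose P n := `[< exists l, [/\ dispersed r l, forall c, c \in l -> ball x s c & size l = n] >].
have P0 : exists n, P n by exists 0%N; apply/asboolP; exists [::].
have PM n : P n -> (n <= Num.bound (D ^+ k))%N.
  move=> /asboolP[l [sl lx <-]]; rewrite -(ler_nat R); apply: ltW.
  apply: (@le_lt_trans _ _ (D ^+ k)).
    apply: (@dispersed_size r s l x k) => //; first exact: ltW.
    by move=> c /lx; rewrite ballEmdist metric_sym.
  by apply: archi_boundP; rewrite exprn_ge0// (le_trans _ D1).
have [n /asboolP[l [sl lx ln]] nmax] := ex_maxnP P0 PM.
exists l; split => // z xz; apply: contrapT => nz.
suff : (n.+1 <= n)%N by rewrite ltnn.
apply: nmax; apply/asboolP; exists (z :: l); split; last by rewrite /= ln.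
  rewrite /dispersed/= -/(dispersed r l) sl andbT; apply/allP => c cl.
  rewrite leNgt; apply/negP => zc; apply: nz; exists c => //.
  by rewrite ballEmdist/= metric_sym.
by move=> c; rewrite inE => /predU1P[->|/lx].
Qed.

End nets.

(** * Telescoping *)

Section averages.
Context {R : realType} {d : measure_display} {X : borelMetricType R d}.
Variable mu : {measure set X -> \bar R}.
Hypothesis mms : metric_measure_space mu.
Implicit Types (x c : X) (r s k : R) (u : X -> R).

Lemma ball_integrable_cst x r k : 0 < r -> mu.-integrable (ball x r) (EFin \o cst k).
Proof.
by move=> r0; exact: (@ball_integrable_bounded _ _ _ mu mms x r `|k| (cst k) r0 (measurable_cst k)).
Qed.

Lemma raverage_sub_le x r u k : 0 < r -> L1loc mu u ->
  (`|raverage mu (ball x r) u - k|%:E <=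
   ((fine (mu (ball x r)))^-1)%:E * \int[mu]_(y in ball x r) `|u y - k|%:E)%E.
Proof.
move=> r0 [mu_ /(_ x r r0) iu]; have m0 := ball_measure_gt0 mms x r0.
set m := fine _ in m0 *.
have mE := ball_measureE mms x r0; rewrite -/m in mE.
have iuf := integrable_fin_num (borel_ball x r) iu.
have -> : (`|raverage mu (ball x r) u - k|%:E =
    m^-1%:E * `|\int[mu]_(y in ball x r) ((u y)%:E - (cst k y)%:E)|)%E.
  rewrite integralB_EFin//; [|exact: borel_ball|exact: ball_integrable_cst].
  rewrite (_ : (\int[mu]_(y in ball x r) (cst k y)%:E = k%:E * mu (ball x r))%E); last first.
    by rewrite -(integral_cst mu (borel_ball x r)).
  rewrite mE /raverage averageE// -/m.
  change (EFin \o u) with (fun y => (u y)%:E) in iuf |- *.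
  rewrite -(fineK iuf) -!EFinM/=; congr EFin.
  have mi : `|m^-1| = m^-1 by rewrite ger0_norm// invr_ge0 ltW.
  rewrite -[in RHS]mi -normrM.
  by rewrite mulrBr [_ * (k * m)]mulrCA mulVf ?gt_eqF// mulr1.
apply: lee_wpmul2l; first by rewrite lee_fin invr_ge0 ltW.
apply: le_trans (le_abse_integral mu (borel_ball x r) _) _.
  apply: emeasurable_funB; last by apply/measurable_EFinP; exact: measurable_cst.
  by apply/measurable_EFinP; exact: measurable_funTS.
by apply: ge0_subset_le_integral.
Qed.

(** Used with [k] the average over the larger ball, to compare averages over two balls contained in
    it. *)
Lemma raverage_dist_le x c r s u k : 0 < r -> 0 < s -> L1loc mu u ->
  ball x r `<=` ball c s ->
  (`|raverage mu (ball x r) u - k|%:E <=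
   ((fine (mu (ball x r)))^-1)%:E * \int[mu]_(y in ball c s) `|u y - k|%:E)%E.
Proof.
move=> r0 s0 lu xc; apply: le_trans (raverage_sub_le x k r0 lu) _.
apply: lee_wpmul2l; first by rewrite lee_fin invr_ge0 ltW// ball_measure_gt0.
exact: ge0_subset_le_integral.
Qed.

End averages.

Section chain.
Context {R : realType} {d : measure_display} {X : borelMetricType R d}.
Variable mu : {measure set X -> \bar R}.
Hypothesis mms : metric_measure_space mu.
Variable D : R.
Hypothesis D1 : 1 <= D.
Hypothesis muD : forall (x : X) (r : R), 0 < r ->
  fine (mu (ball x (2 * r))) <= D * fine (mu (ball x r)).
Variables (p C sigma : R).
Hypotheses (p1 : 1 <= p) (C0 : 0 < C) (sigma1 : 1 <= sigma).
Variables (u : X -> R) (g : X -> \bar R).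
Hypothesis lu : L1loc mu u.
Hypothesis poincare : forall (x : X) (r : R), 0 < r ->
  (average mu (ball x r) (fun y => `|u y - raverage mu (ball x r) u|%:E) <=
   (C * r)%:E * (average mu (ball x (sigma * r)) (fun y => g y `^ p)) `^ p^-1)%E.
Implicit Types (x c : X) (r s J : R).

Let p0 : 0 < p. Proof. by rewrite (lt_le_trans _ p1). Qed.

(** The Poincare inequality multiplied out by the measure, so that it can be summed over a net.
    Dividing [J] by the measure of [ball c r] rather than that of [ball c (sigma * r)] only weakens
    it. *)
Lemma poincare_integral c r J : 0 < r -> 0 <= J ->
  (\int[mu]_(y in ball c (sigma * r)) (g y `^ p) <= J%:E)%E ->
  (\int[mu]_(y in ball c r) `|u y - raverage mu (ball c r) u|%:E <=
   (fine (mu (ball c r)) * (C * r * (J / fine (mu (ball c r))) `^ p^-1))%:E)%E.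
Proof.
move=> r0 J0 hJ; have m0 := ball_measure_gt0 mms c r0.
have sr0 : 0 < sigma * r by rewrite mulr_gt0// (lt_le_trans _ sigma1).
have ms0 := ball_measure_gt0 mms c sr0.
have mle : fine (mu (ball c r)) <= fine (mu (ball c (sigma * r))).
  by apply: ball_measure_le => //; apply: le_ball; rewrite ler_peMl// ltW.
have := poincare c r0; rewrite [leLHS]averageE//.
set I := (\int[mu]_(y in _) _)%E; set B := average _ _ _ => h.
set m := fine (mu (ball c r)) in m0 h mle *.
have B0 : (0 <= B)%E by apply: average_ge0 => // y; exact: poweR_ge0.
have hB : (B <= (J / m)%:E)%E.
  rewrite /B averageE//.
  apply: (@le_trans _ _ ((fine (mu (ball c (sigma * r))))^-1%R%:E * J%:E)%E).
    by apply: lee_wpmul2l => //; rewrite lee_fin invr_ge0 ltW.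
  by rewrite -EFinM lee_fin mulrC ler_wpM2l// lef_pV2.
clearbody B; have p10 : 0 <= p^-1 by rewrite invr_ge0 ltW.
have hB' := le_poweR p10 B0 hB; rewrite poweR_EFin in hB'.
have Cr0 : (0 <= (C * r)%:E)%E by rewrite lee_fin mulr_ge0// ltW.
have {h} := le_trans h (lee_wpmul2l Cr0 hB').
rewrite -EFinM => h.
have -> : I = (m%:E * (m^-1%:E * I))%E.
  by rewrite muleA -EFinM divff ?gt_eqF// mul1e.
by rewrite EFinM; apply: lee_wpmul2l => //; rewrite lee_fin ltW.
Qed.

(** Both averages are compared with the one over [ball c (2 * r)], which contains both balls and
    lies in [ball c' (4 * r)]; as [4 * r = 2 ^+ 4 * (r / 4)], the measures are comparable up to
    [D ^+ 4]. One factor 2 comes from the radius [2 * r], the other from the triangle inequality. *)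
Lemma chain_step c c' r J : 0 < r -> 0 <= J -> mdist c c' < 5 / 4 * r ->
  (\int[mu]_(y in ball c (2 * sigma * r)) (g y `^ p) <= J%:E)%E ->
  `|raverage mu (ball c r) u - raverage mu (ball c' (r / 4)) u| <=
  4 * D ^+ 4 * C * r * (J / fine (mu (ball c r))) `^ p^-1.
Proof.
move=> r0 J0 cc' hJ.
have r20 : 0 < 2 * r by rewrite mulr_gt0.
have r40 : 0 < r / 4 by rewrite divr_gt0.
have r160 : 0 < 4 * r by rewrite mulr_gt0.
have m0 := ball_measure_gt0 mms c r0; have M0 := ball_measure_gt0 mms c r20.
have m'0 := ball_measure_gt0 mms c' r40.
set m := fine (mu (ball c r)) in m0 *.
set k := raverage mu (ball c (2 * r)) u.
rewrite [2 * sigma]mulrC -mulrA in hJ.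
have hI := poincare_integral r20 J0 hJ; rewrite -/k in hI.
set M := fine (mu (ball c (2 * r))) in M0 hI.
set m' := fine (mu (ball c' (r / 4))) in m'0.
have sub1 : ball c r `<=` ball c (2 * r) by apply: le_ball; lra.
have sub2 : ball c' (r / 4) `<=` ball c (2 * r).
  move=> y; rewrite !ballEmdist/= => h; have := metric_triangle c c' y; lra.
have sub3 : ball c (2 * r) `<=` ball c' (2 ^+ 4 * (r / 4)).
  have -> : 2 ^+ 4 * (r / 4) = 4 * r by field.
  move=> y; rewrite !ballEmdist/= => h; have := metric_triangle c' c y.
  rewrite (metric_sym c' c); lra.
have mi0 : (0 <= (m^-1)%:E)%E by rewrite lee_fin invr_ge0 ltW.
have m'i0 : (0 <= (m'^-1)%:E)%E by rewrite lee_fin invr_ge0 ltW.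
have h1 := le_trans (raverage_dist_le mms k r0 r20 lu sub1) (lee_wpmul2l mi0 hI).
have h2 := le_trans (raverage_dist_le mms k r40 r20 lu sub2) (lee_wpmul2l m'i0 hI).
have mM : m <= M by apply: ball_measure_le.
have D10 : 0 <= D by rewrite (le_trans _ D1).
have D41 : D <= D ^+ 4 by rewrite -{1}(expr1 D) ler_weXn2l.
have Mm : M <= D ^+ 4 * m.
  by rewrite (le_trans (muD c r0))// ler_wpM2r// ltW.
have Mm' : M <= D ^+ 4 * m'.
  apply: le_trans (doubling_iter D1 muD 4 c' r40).
  by apply: ball_measure_le => //; rewrite mulr_gt0// exprn_gt0.
have E0 : 0 <= (J / m) `^ p^-1 by exact: powR_ge0.
have ME : (J / M) `^ p^-1 <= (J / m) `^ p^-1.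
  apply: ge0_ler_powR; rewrite ?nnegrE ?invr_ge0; [exact: ltW|..].
  - by rewrite divr_ge0// ltW.
  - by rewrite divr_ge0// ltW.
  - by rewrite ler_wpM2l// lef_pV2.
rewrite -EFinM lee_fin in h1; rewrite -EFinM lee_fin in h2.
have key n : 0 < n -> M <= D ^+ 4 * n ->
    n^-1 * (M * (C * (2 * r) * (J / M) `^ p^-1)) <=
    2 * D ^+ 4 * C * r * (J / m) `^ p^-1.
  move=> n0 Mn; rewrite [leLHS]mulrA [leRHS](_ : _ = D ^+ 4 * (C * (2 * r) * (J / m) `^ p^-1)); last by ring.
  apply: ler_pM.
  - by apply: mulr_ge0; rewrite ?invr_ge0 ltW.
  - by rewrite !mulr_ge0 ?powR_ge0 ?(ltW C0) ?(ltW r0).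
  - by rewrite mulrC ler_pdivrMr.
  - by rewrite ler_wpM2l// !mulr_ge0 ?(ltW C0) ?(ltW r0).
have {}h1 := le_trans h1 (key _ m0 Mm).
have {}h2 := le_trans h2 (key _ m'0 Mm').
rewrite [raverage _ _ _ - _](_ : _ = (raverage mu (ball c r) u - k) - (raverage mu (ball c' (r / 4)) u - k)); last by ring.
apply: (le_trans (ler_normB _ _)).
apply: (le_trans (lerD h1 h2)); rewrite le_eqVlt; apply/orP; left; apply/eqP; ring.
Qed.

End chain.

(** * Sums of functions cut off to the members of a family of sets *)

Section patch_sums.
Context d (T : measurableType d) (R : realType) (mu : {measure set T -> \bar R}).
Variables (I : eqType) (E : I -> set T) (w : I -> T -> \bar R).
Hypothesis mE : forall c, measurable (E c).
Hypothesis mw : forall c, measurable_fun setT (w c).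
Hypothesis w0 : forall c z, (0 <= w c z)%E.
Local Open Scope ereal_scope.

Lemma patch_ge0 c z : 0 <= (w c \_ (E c)) z.
Proof. by rewrite /patch; case: ifP. Qed.

Lemma measurable_sum_patch (l : seq I) :
  measurable_fun setT (fun z => \sum_(c <- l) (w c \_ (E c)) z).
Proof.
apply: emeasurable_sum => c; apply/(measurable_restrictT (w c) (mE c)).
exact: measurable_funTS.
Qed.

Lemma sum_patch_ge (l : seq I) c z : c \in l -> E c z ->
  w c z <= \sum_(c <- l) (w c \_ (E c)) z.
Proof.
move=> cl Ez; rewrite (big_rem c)//= {1}/patch mem_set// leeDl//.
by apply: sume_ge0 => b _; exact: patch_ge0.
Qed.

Lemma integral_sum_patch (l : seq I) (F : set T) : measurable F ->
  \int[mu]_(z in F) (\sum_(c <- l) (w c \_ (E c)) z) <=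
  \sum_(c <- l) \int[mu]_(z in E c) w c z.
Proof.
move=> mF; rewrite ge0_integral_sum//; last 2 first.
- move=> c; apply: measurable_funTS; apply/(measurable_restrictT (w c) (mE c)).
  exact: measurable_funTS.
- by move=> c z _; exact: patch_ge0.
apply: lee_sum => c _; rewrite -integral_mkcondr.
by apply: ge0_subset_le_integral => // z [].
Qed.

End patch_sums.

Lemma nneseries_geometric_le {R : realType} (a : nat -> \bar R) (M t : R) :
  0 <= M -> 0 <= t < 1 -> (forall i, (0 <= a i)%E) ->
  (forall i, (a i <= (M * t ^+ i)%:E)%E) ->
  (\sum_(0 <= i <oo) a i <= (M / (1 - t))%:E)%E.
Proof.
move=> M0 /andP[t0 t1] a0 aM.
have t10 : 0 < 1 - t by rewrite subr_gt0.
apply: lime_le; first by apply: is_cvg_nneseries => n _ _; exact: a0.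
apply: nearW => n.
apply: (@le_trans _ _ (\sum_(0 <= i < n) (M * t ^+ i)%:E)%E); first exact: lee_sum.
rewrite sumEFin lee_fin.
suff -> : \sum_(0 <= i < n) M * t ^+ i = M * (1 - t ^+ n) / (1 - t).
  rewrite ler_wpM2r ?invr_ge0 ?(ltW t10)// ler_piMr// gerBl exprn_ge0//.
elim: n => [|n ih]; first by rewrite big_nil expr0 subrr mulr0 mul0r.
by rewrite big_nat_recr//= ih exprS; field; rewrite gt_eqF.
Qed.

(** Linearizes the power [p^-1] of the energy density, so that sums over a net need only the total
    measure and the total energy. *)
Lemma powR_le1D {R : realType} (a s : R) : 0 <= a -> 0 <= s <= 1 -> a `^ s <= 1 + a.
Proof.
move=> a0 /andP[s0 s1]; have [a1|/ltW a1] := leP a 1.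
  apply: (@le_trans _ _ 1); last by rewrite lerDl.
  have <- : 1 `^ s = 1 :> R by rewrite powR1.
  by apply: ge0_ler_powR; rewrite ?nnegrE.
by apply: le_trans (ler1_powR a1 s1) _; rewrite lerDr.
Qed.

(** * Approximation of [u] on a fixed ball at the scales [r / 4 ^+ i] *)

Section telescope.
Context {R : realType} {d : measure_display} {X : borelMetricType R d}.
Variable mu : {measure set X -> \bar R}.
Hypothesis mms : metric_measure_space mu.
Variable D : R.
Hypothesis D1 : 1 <= D.
Hypothesis muD : forall (x : X) (r : R), 0 < r ->
  fine (mu (ball x (2 * r))) <= D * fine (mu (ball x r)).
Variables (p C sigma : R).
Hypotheses (p1 : 1 <= p) (C0 : 0 < C) (sigma1 : 1 <= sigma).
Variables (u : X -> R) (g : X -> \bar R).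
Hypothesis lu : L1loc mu u.
Hypothesis mg : measurable_fun setT g.
Hypothesis poincare : forall (x : X) (r : R), 0 < r ->
  (average mu (ball x r) (fun y => `|u y - raverage mu (ball x r) u|%:E) <=
   (C * r)%:E * (average mu (ball x (sigma * r)) (fun y => g y `^ p)) `^ p^-1)%E.
Variables (x0 : X) (r : R) (k N : nat) (G : R).
Hypotheses (r0 : 0 < r) (hk : 8 * sigma + 1 <= 2 ^+ k) (hN : D ^+ k < N%:R).
(** All balls of radius [2 * sigma * rho i] centred in [ball x0 r] stay in [ball x0 (Lam * r)],
    because [rho i <= r]. *)
Local Notation Lam := (1 + 2 * sigma).
Hypothesis GE : (\int[mu]_(y in ball x0 (Lam * r)) (g y `^ p) = G%:E)%E.
Local Notation m c s := (fine (mu (ball c s))).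
Local Notation rho i := (r / 4 ^+ i).
Variable net : nat -> seq X.
Hypothesis net_sep : forall i, dispersed (rho i) (net i).
Hypothesis net_sub : forall i c, c \in net i -> ball x0 r c.
Hypothesis net_cov : forall i z, ball x0 r z -> exists2 c, c \in net i & ball c (rho i) z.
Hypothesis net0 : net 0%N = [:: x0].

Let p0 : 0 < p. Proof. by rewrite (lt_le_trans _ p1). Qed.
Let s0 : 0 < sigma. Proof. by rewrite (lt_le_trans _ sigma1). Qed.
Let rho0 i : 0 < rho i. Proof. by rewrite divr_gt0// exprn_gt0. Qed.
Let rho_le i : rho i <= r.
Proof. by rewrite ler_pdivrMr ?exprn_gt0// ler_peMr ?(ltW r0)// exprn_ege1// ler1n. Qed.
Let big0 i : 0 < 2 * sigma * rho i. Proof. by rewrite !mulr_gt0. Qed.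
Let Lam0 : 0 < Lam * r. Proof. by rewrite mulr_gt0// addr_gt0// mulr_gt0. Qed.
Let Lam_k : Lam * r + r <= 2 ^+ k * r.
Proof.
rewrite -[X in _ + X]mul1r -mulrDl; apply: ler_wpM2r; first exact: ltW.
by apply: le_trans hk; move: (sigma1); lra.
Qed.
Let G0 : 0 <= G.
Proof. by rewrite -lee_fin -GE; apply: integral_ge0 => y _; exact: poweR_ge0. Qed.
Let mgp : measurable_fun setT (fun y => g y `^ p)%E.
Proof. exact: (measurableT_comp (measurable_poweR p)). Qed.

Let sub_big i c : ball x0 r c -> ball c (2 * sigma * rho i) `<=` ball x0 (Lam * r).
Proof.
rewrite !ballEmdist/= => xc y /= cy.
have h : 2 * sigma * rho i <= 2 * sigma * r by rewrite ler_wpM2l// mulr_ge0// ltW.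
by have := metric_triangle x0 c y; rewrite mulrDl mul1r; lra.
Qed.

(** The energy on the dilated ball that [chain_step] asks for; for centres in [ball x0 r] it is
    finite, at most [G]. *)
Let J (c : X) (i : nat) : R := fine (\int[mu]_(y in ball c (2 * sigma * rho i)) (g y `^ p))%E.

Let J_le i c : ball x0 r c ->
  (\int[mu]_(y in ball c (2 * sigma * rho i)) (g y `^ p) <= G%:E)%E.
Proof.
move=> xc; rewrite -GE; apply: ge0_subset_le_integral => [|y _|y _|//].
- exact: sub_big.
- exact: poweR_ge0.
- exact: poweR_ge0.
Qed.

Let JE i c : ball x0 r c ->
  (\int[mu]_(y in ball c (2 * sigma * rho i)) (g y `^ p) = (J c i)%:E)%E.
Proof.
move=> xc; rewrite fineK// ge0_fin_numE; first by rewrite (le_lt_trans (J_le i xc))// ltry.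
by apply: integral_ge0 => y _; exact: poweR_ge0.
Qed.

Let J0 c i : 0 <= J c i.
Proof. by apply: fine_ge0; apply: integral_ge0 => y _; exact: poweR_ge0. Qed.

(** This is where [8 * sigma + 1 <= 2 ^+ k] comes from: it is the condition of [dispersed_overlap]
    for balls of radius [2 * sigma * rho i], divided by [rho i]. *)
Let overlap i z : (count (fun c => z \in (ball c (2 * sigma * rho i) : set X)) (net i) <= N)%N.
Proof.
rewrite -(ler_nat R); apply: le_trans (ltW hN).
apply: (dispersed_overlap mms D1 muD z (rho0 i) (ltW (big0 i)) (net_sep i)).
by apply: le_trans (ler_wpM2r (ltW (rho0 i)) hk); rewrite mulrDl mul1r; lra.
Qed.

Let sum_J i : (\sum_(c <- net i) (J c i)%:E <= (N%:R * G)%:E)%E.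
Proof.
rewrite EFinM -GE.
rewrite (eq_big_seq (fun c => \int[mu]_(y in ball c (2 * sigma * rho i)) (g y `^ p))%E).
  apply: integral_overlap => //; try by move=> *; exact: borel_ball.
  - by move=> z; exact: poweR_ge0.
  - by move=> c /net_sub; exact: sub_big.
by move=> c /net_sub xc; rewrite JE.
Qed.

Let sum_m i : (\sum_(c <- net i) (m c (rho i))%:E <= (N%:R * m x0 (Lam * r))%:E)%E.
Proof.
apply: (@le_trans _ _ (\sum_(c <- net i) \int[mu]_(y in ball c (2 * sigma * rho i)) (cst 1 y))%E).
  apply: lee_sum => c _; rewrite integral_cst ?mul1e; last exact: borel_ball.
  rewrite (ball_measureE mms c (big0 i)) lee_fin; apply: ball_measure_le => //.
  apply: le_ball; rewrite ler_peMl ?(ltW (rho0 i))//.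
  by rewrite (le_trans sigma1)// ler_peMl ?ltW// ltr1n.
rewrite EFinM -(ball_measureE mms)// -[X in (_ * X)%E]mul1e -integral_cst; last exact: borel_ball.
apply: integral_overlap => //; try by move=> *; exact: borel_ball.
by move=> c /net_sub; exact: sub_big.
Qed.

Let t (c : X) (i : nat) : R := J c i / m c (rho i).

Let t0 c i : 0 <= t c i.
Proof. by rewrite divr_ge0// ltW// ball_measure_gt0. Qed.

(** The energy is at most [G], and [ball x0 (Lam * r)] lies in [ball c (2 ^+ k * r)]. Since
    [r = 2 ^+ (2 * i) * rho i], doubling [k + 2 * i] times compares the measure of that ball with
    the one of [ball c (rho i)]. *)
Let t_le i c : ball x0 r c ->
  t c i <= D ^+ k * (D ^+ 2) ^+ i * (G / m x0 (Lam * r)).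
Proof.
move=> xc; have mc := ball_measure_gt0 mms c (rho0 i).
have mL := ball_measure_gt0 mms x0 Lam0.
rewrite ler_pdivrMr// (_ : _ * _ * _ * _ =
  G * ((D ^+ k * ((D ^+ 2) ^+ i * m c (rho i))) / m x0 (Lam * r))); last by ring.
apply: (@le_trans _ _ G); first by rewrite -lee_fin -JE// J_le.
rewrite ler_peMr// ler_pdivlMr// mul1r.
have h1 : m x0 (Lam * r) <= m c (2 ^+ k * r).
  apply: ball_measure_le => //; first by rewrite mulr_gt0// exprn_gt0.
  move=> y; move: xc; rewrite !ballEmdist/= => xc xy.
  have := metric_triangle c x0 y; rewrite (metric_sym c x0).
  move=> /le_lt_trans; apply; apply: lt_le_trans Lam_k.
  by rewrite addrC ltrD.
apply: (le_trans h1); apply: (le_trans (doubling_iter D1 muD k c r0)).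
rewrite ler_wpM2l ?exprn_ge0 ?(le_trans _ D1)//.
have := doubling_iter D1 muD (2 * i) c (rho0 i).
rewrite exprM -exprM (_ : 2 ^+ (2 * i) * rho i = r) ?exprM//.
by rewrite -natrX mulrC divfK// expf_neq0.
Qed.

Let U (c : X) (i : nat) : R := raverage mu (ball c (rho i)) u.
(** [F] and [H] sum over all net balls containing [z]. They are therefore measurable, and they
    dominate the terms of the one ball selected by [cell] below, whose measurability then never
    arises. *)
Let F (i : nat) (z : X) : \bar R :=
  (\sum_(c <- net i) ((fun=> (t c i)%:E) \_ (ball c (rho i))) z)%E.
Let H (i : nat) (z : X) : \bar R :=
  (\sum_(c <- net i) ((fun y => `|u y - U c i|%:E) \_ (ball c (rho i))) z)%E.

Let F0 i z : (0 <= F i z)%E.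
Proof. by apply: sume_ge0 => c _; rewrite /patch; case: ifP => // _; rewrite lee_fin. Qed.

Let H0 i z : (0 <= H i z)%E.
Proof. by apply: sume_ge0 => c _; rewrite /patch; case: ifP => // _; rewrite lee_fin. Qed.

Let mF i : measurable_fun setT (F i).
Proof.
apply: measurable_sum_patch => c; first exact: borel_ball.
exact: measurable_cst.
Qed.

Let mdev k' : measurable_fun setT (fun y => `|u y - k'|%:E).
Proof.
apply/measurable_EFinP; apply: measurableT_comp => //.
by apply: measurable_funB; [case: lu|exact: measurable_cst].
Qed.

Let mH i : measurable_fun setT (H i).
Proof. by apply: measurable_sum_patch => c; [exact: borel_ball|exact: mdev]. Qed.

Let int_F i : (\int[mu]_(z in ball x0 r) F i z <= (N%:R * G)%:E)%E.
Proof.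
apply: le_trans (sum_J i).
apply: le_trans (integral_sum_patch _ _ _ _ _ _) _.
- by move=> c; exact: borel_ball.
- by move=> c; exact: measurable_cst.
- by move=> c z; rewrite lee_fin.
- exact: borel_ball.
apply: lee_sum => c _.
rewrite (integral_cst mu (borel_ball c (rho i)) (t c i)%:E).
rewrite (ball_measureE mms c (rho0 i)) -EFinM lee_fin /t divfK//.
by rewrite gt_eqF// ball_measure_gt0.
Qed.

(** Poincare on each net ball gives [C * rho i] times measure plus energy; bounded overlap sums
    these, and the factor [rho i] gives the geometric decay. *)
Let int_H i : (\int[mu]_(z in ball x0 r) H i z <=
  (C * r * (N%:R * m x0 (Lam * r) + N%:R * G) * 4^-1 ^+ i)%:E)%E.
Proof.
apply: le_trans (integral_sum_patch _ _ _ _ _ _) _.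
- by move=> c; exact: borel_ball.
- by move=> c; exact: mdev.
- by move=> c z; rewrite lee_fin.
- exact: borel_ball.
apply: (@le_trans _ _ (\sum_(c <- net i)
    ((C * rho i)%:E * ((m c (rho i))%:E + (J c i)%:E)))%E).
  rewrite big_seq [leRHS]big_seq; apply: lee_sum => c /net_sub xc.
  have hJ : (\int[mu]_(y in ball c (sigma * rho i)) (g y `^ p) <= (J c i)%:E)%E.
    rewrite -JE//; apply: ge0_subset_le_integral => [|y _|y _|//].
    - by apply: le_ball; rewrite ler_wpM2r ?(ltW (rho0 i))// ler_peMl ?ler1n// ltW.
    - exact: poweR_ge0.
    - exact: poweR_ge0.
  have := poincare_integral mms p1 C0 sigma1 poincare (rho0 i) (J0 c i) hJ.
  move=> /le_trans; apply.
  have mc := ball_measure_gt0 mms c (rho0 i).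
  rewrite -EFinD -EFinM lee_fin mulrCA; apply: ler_wpM2l.
    by rewrite mulr_ge0// ltW.
  rewrite -[leRHS](_ : m c (rho i) * (1 + t c i) = _); last first.
    by rewrite mulrDr mulr1 /t mulrCA divff ?mulr1// gt_eqF.
  apply: ler_wpM2l; first exact: ltW.
  by apply: powR_le1D; rewrite ?t0// invr_ge0 (ltW p0)/= invf_le1.
rewrite -ge0_sume_distrr; last by move=> c _; rewrite -EFinD lee_fin addr_ge0// ltW// ball_measure_gt0.
rewrite big_split/=.
rewrite -[leRHS](_ : ((C * rho i)%:E * ((N%:R * m x0 (Lam * r))%:E + (N%:R * G)%:E) = _)%E); last first.
  by rewrite -EFinD -EFinM exprVn; congr EFin; ring.
by apply: lee_wpmul2l; [rewrite lee_fin mulr_ge0 ?ltW|apply: leeD].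
Qed.

(** One net ball containing [z] at each scale; on [ball x0 r] the default [x0] of [xget] never
    occurs for lack of such a ball, by [net_cov]. *)
Let cell (i : nat) (z : X) : X := xget x0 [set c | c \in net i /\ ball c (rho i) z].

Let cellP i z : ball x0 r z -> cell i z \in net i /\ ball (cell i z) (rho i) z.
Proof.
move=> xz; rewrite /cell; case: xgetP => [c _ []//|nc].
by have [c cn cz] := net_cov i xz; case: (nc c).
Qed.

Let F_ge i z : ball x0 r z -> ((t (cell i z) i)%:E <= F i z)%E.
Proof.
move=> /(cellP i)[cn cz].
apply: (@sum_patch_ge _ _ _ _ (fun c => ball c (rho i)) (fun c _ => (t c i)%:E)) => //.
by move=> c y; rewrite lee_fin.
Qed.

Let H_ge i z : ball x0 r z -> (`|u z - U (cell i z) i|%:E <= H i z)%E.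
Proof.
move=> /(cellP i)[cn cz].
apply: (@sum_patch_ge _ _ _ _ (fun c => ball c (rho i)) (fun c y => `|u y - U c i|%:E)) => //.
Qed.

Let K := 4 * D ^+ 4 * C.

Let K0 : 0 < K.
Proof.
have D0 : 0 < D by rewrite (lt_le_trans _ D1).
by rewrite mulr_gt0// mulr_gt0// exprn_gt0.
Qed.

Let U_step i z : ball x0 r z ->
  `|U (cell i z) i - U (cell i.+1 z) i.+1| <= K * rho i * t (cell i z) i `^ p^-1.
Proof.
move=> xz; have [cn cz] := cellP i xz; have [cn' cz'] := cellP i.+1 xz.
have rS : rho i.+1 = rho i / 4 by rewrite exprSr invfM mulrA.
rewrite /U rS; apply: (chain_step mms D1 muD p1 C0 sigma1 lu poincare) => //.
- move: cz cz'; rewrite rS !ballEmdist/= => cz cz'.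
  have := metric_triangle (cell i z) z (cell i.+1 z).
  rewrite (metric_sym z); lra.
- by rewrite JE//; exact: net_sub cn.
Qed.

Variable e : R.
Hypotheses (e0 : 0 < e) (De : (D ^+ 2) `^ e <= 3 / 2).
Local Notation q := (p * (1 + e)).
Let A := G / m x0 (Lam * r).
Let w (i : nat) : R := (D ^+ k * A) `^ e * (3 / 4) ^+ i.
Let Y (z : X) : \bar R := (\sum_(0 <= i <oo) (w i)%:E * F i z)%E.

Let D0 : 0 < D. Proof. by rewrite (lt_le_trans _ D1). Qed.
Let q0 : 0 < q. Proof. by rewrite mulr_gt0// addr_gt0. Qed.
Let q1 : 1 <= q. Proof. by rewrite mulr_ege1// lerDl ltW. Qed.
Let A0 : 0 <= A. Proof. by rewrite divr_ge0// ltW// ball_measure_gt0. Qed.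
Let w0 i : 0 <= w i. Proof. by rewrite mulr_ge0 ?powR_ge0// exprn_ge0. Qed.

Let wF0 i z : (0 <= (w i)%:E * F i z)%E.
Proof. by rewrite mule_ge0// lee_fin. Qed.

Let weight i c : ball x0 r c ->
  (2^-1 ^+ i * t c i `^ p^-1) `^ q <= w i * t c i.
Proof.
move=> xc; have tc := t0 c i; have tle := t_le i xc; rewrite -/A in tle.
move: (t c i) tc tle => tc tc0 tle.
have hi : 0 < (2^-1 : R) ^+ i by rewrite exprn_gt0.
have hi1 : (2^-1 : R) ^+ i <= 1 by rewrite exprn_ile1// invf_le1// ler1n.
rewrite powRM ?powR_ge0 ?(ltW hi)// -powRrM mulrA mulVf ?gt_eqF// mul1r.
have -> : tc `^ (1 + e) = tc * tc `^ e.
  by rewrite -[in RHS](addrK 1 e) mulr_powRB1 ?addr_gt0// addrC.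
rewrite mulrCA [leRHS]mulrC; apply: ler_wpM2l => //.
have h1 : (2^-1 ^+ i : R) `^ q <= 2^-1 ^+ i by apply: ge1r_powR => //; rewrite hi.
have h2 : tc `^ e <= (D ^+ k * A) `^ e * (3 / 2) ^+ i.
  apply: (@le_trans _ _ ((D ^+ k * (D ^+ 2) ^+ i * A) `^ e)).
    apply: ge0_ler_powR; rewrite ?nnegrE; [exact: ltW|exact: tc0| |exact: tle].
    exact: le_trans tle.
  have Dk0 : 0 <= D ^+ k by rewrite exprn_ge0// ltW.
  have D20 : 0 <= D ^+ 2 by rewrite exprn_ge0// ltW.
  rewrite [_ * _ * A]mulrAC (@powRM _ (D ^+ k * A)); [|exact: mulr_ge0|exact: exprn_ge0].
  apply: ler_wpM2l; first exact: powR_ge0.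
  rewrite -(powR_mulrn i D20) powRAC powR_mulrn ?powR_ge0//.
  by apply: lerXn2r; rewrite ?nnegrE ?powR_ge0// divr_ge0.
apply: (le_trans (ler_pM (powR_ge0 _ _) (powR_ge0 _ _) h1 h2)).
rewrite /w le_eqVlt; apply/orP; left; apply/eqP.
rewrite mulrCA -exprMn; congr (_ * _ ^+ _); lra.
Qed.

(* Each term of a nonnegative series is at most its sum, so the increments are
   bounded by a geometric sequence times [(Y z)^(1/q)]; no Minkowski inequality. *)
Let pointwise z : ball x0 r z -> ((\sum_(0 <= i <oo) H i z)%E \is a fin_num) ->
  ((`|u z - raverage mu (ball x0 r) u| `^ q)%:E <= ((2 * (K * r)) `^ q)%:E * Y z)%E.
Proof.
move=> xz Hfin.
have Kr0 : 0 < K * r by rewrite mulr_gt0.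
have KR0 : 0 < 2 * (K * r) by rewrite mulr_gt0.
have Y0 : (0 <= Y z)%E by apply: nneseries_ge0 => i _ _; exact: wF0.
have [Yy|Yfin] := eqVneq (Y z) +oo%E.
  by rewrite Yy gt0_muley ?leey// lte_fin powR_gt0.
have [y y0 YE] : exists2 y, 0 <= y & Y z = y%:E.
  by exists (fine (Y z)); [exact: fine_ge0|rewrite fineK// ge0_fin_numE// ltey].
have ty i : 2^-1 ^+ i * t (cell i z) i `^ p^-1 <= y `^ q^-1.
  have [cn cz] := cellP i xz.
  have h : (2^-1 ^+ i * t (cell i z) i `^ p^-1) `^ q <= y.
    apply: (le_trans (weight i (net_sub cn))); rewrite -lee_fin -YE EFinM.
    apply: (@le_trans _ _ ((w i)%:E * F i z)%E).
      by apply: lee_wpmul2l; [rewrite lee_fin|exact: F_ge].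
    apply: le_trans (nneseries_lim_ge i.+1 _); last by move=> n _ _; exact: wF0.
    rewrite big_nat_recr//= leeDr//.
    by apply: sume_ge0 => n _; exact: wF0.
  have b0 : 0 <= 2^-1 ^+ i * t (cell i z) i `^ p^-1.
    by rewrite mulr_ge0 ?powR_ge0// exprn_ge0.
  have qK a : 0 <= a -> a = (a `^ q) `^ q^-1.
    by move=> a0; rewrite -powRrM mulfV ?lt0r_neq0// powRr1.
  rewrite [leLHS]qK//; apply: ge0_ler_powR; rewrite ?nnegrE ?powR_ge0//.
  by rewrite invr_ge0 ltW.
set b := y `^ q^-1 in ty; have b0 : 0 <= b by exact: powR_ge0.
have step i : `|U (cell i z) i - U (cell i.+1 z) i.+1| <= K * r * 2^-1 ^+ i * b.
  apply: (le_trans (U_step i xz)).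
  have -> : K * rho i * t (cell i z) i `^ p^-1 =
      K * r * 2^-1 ^+ i * (2^-1 ^+ i * t (cell i z) i `^ p^-1).
    (* One factor [2^-1 ^+ i] is spent in [ty]; the other makes the telescoping sum converge. *)
    have -> : (4 ^+ i)^-1 = 2^-1 ^+ i * 2^-1 ^+ i :> R.
      by rewrite -exprMn -exprVn; congr (_ ^+ _); lra.
    ring.
  by apply: ler_wpM2l (ty i); rewrite mulr_ge0 ?(ltW Kr0)// exprn_ge0.
have U0E : U (cell 0%N z) 0%N = raverage mu (ball x0 r) u.
  have [+ _] := cellP 0%N xz; rewrite net0 inE => /eqP ->.
  by rewrite /U expr0 divr1.
have tele n : `|U (cell 0%N z) 0%N - U (cell n z) n| <= K * r * b * (2 * (1 - 2^-1 ^+ n)).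
  elim: n => [|n ih]; first by rewrite subrr normr0 expr0 subrr !mulr0.
  have := lerD ih (step n); have := ler_distD (U (cell n z) n) (U (cell 0%N z) 0%N) (U (cell n.+1 z) n.+1).
  move=> /le_trans h /h /le_trans; apply.
  rewrite exprS le_eqVlt; apply/orP; left; apply/eqP.
  by field.
(* If all approximations stayed [eta] away from [u z], every term [H n z] would be at least [eta]
   and the series could not be finite. *)
have close (eta : R) : 0 < eta -> exists n, `|u z - U (cell n z) n| <= eta.
  move=> eta0; apply: contrapT => /forallNP far.
  have Hn n : (eta%:E <= H n z)%E.
    apply: le_trans (H_ge n xz); rewrite lee_fin leNgt; apply/negP => h.
    by apply: (far n); exact: ltW.
  have HS := fineK Hfin; set S := fine _ in HS.
  pose n := Num.bound (`|S| / eta).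
  have : ((n%:R * eta)%:E <= S%:E)%E.
    rewrite HS; apply: le_trans (nneseries_lim_ge n _); last by move=> *; exact: H0.
    apply: (@le_trans _ _ (\sum_(0 <= i < n) eta%:E)%E); last exact: lee_sum.
    by rewrite sumEFin lee_fin sumr_const_nat subn0 mulr_natl.
  rewrite lee_fin leNgt => /negP; apply.
  apply: le_lt_trans (ler_norm S) _; rewrite -ltr_pdivrMr//.
  by apply: archi_boundP; rewrite divr_ge0// ltW.
have main : `|u z - raverage mu (ball x0 r) u| <= 2 * (K * r) * b.
  apply/ler_addgt0Pr => eta eta0; have [n hn] := close _ eta0.
  have := ler_distD (U (cell n z) n) (u z) (U (cell 0%N z) 0%N).
  rewrite U0E; move=> /le_trans; apply; rewrite addrC; apply: lerD => //.
  rewrite distrC -U0E; apply: (le_trans (tele n)).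
  have -> : 2 * (K * r) * b = K * r * b * 2 by ring.
  apply: ler_wpM2l; first by rewrite mulr_ge0// ltW.
  by rewrite ler_piMr// gerBl exprn_ge0.
rewrite YE -EFinM lee_fin.
have -> : (2 * (K * r)) `^ q * y = (2 * (K * r) * b) `^ q.
  rewrite [RHS]powRM ?(ltW KR0)//; congr (_ * _).
  by rewrite /b -powRrM mulVf ?gt_eqF// powRr1.
apply: ge0_ler_powR; rewrite ?nnegrE//; first exact: ltW.
by rewrite mulr_ge0// ltW.
Qed.

Let mseries (f : nat -> X -> \bar R) : (forall i, measurable_fun setT (f i)) ->
  (forall i z, (0 <= f i z)%E) ->
  measurable_fun setT (fun z => \sum_(0 <= i <oo) f i z)%E.
Proof.
move=> mf f0; apply: (@ge0_emeasurable_sum _ _ _ setT f predT) => //.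
Qed.

(** The integrals of the [H i] are bounded by a geometric sequence, so the series is integrable on
    the ball and finite almost everywhere in it. *)
Let H_fin : \forall z \ae mu,
  ball x0 r z -> (\sum_(0 <= i <oo) H i z)%E \is a fin_num.
Proof.
apply: integrable_ae; first exact: borel_ball.
apply/integrableP; split; first by apply: measurable_funTS; exact: mseries.
rewrite (eq_integral (fun z => \sum_(0 <= i <oo) H i z)%E); last first.
  by move=> z _; rewrite gee0_abs//; apply: nneseries_ge0 => i _ _; exact: H0.
rewrite integral_nneseries//; last 2 first.
- exact: borel_ball.
- by move=> i; exact: measurable_funTS.
have M0 : 0 <= C * r * (N%:R * m x0 (Lam * r) + N%:R * G).
  by rewrite mulr_ge0 ?mulr_ge0 ?(ltW C0) ?(ltW r0)// addr_ge0// mulr_ge0// ltW// ball_measure_gt0.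
have q4 : 0 <= (4^-1 : R) < 1 by rewrite invr_ge0 ler0n/= invf_lt1// ltr1n.
apply: le_lt_trans (nneseries_geometric_le M0 q4 _ int_H) (ltry _).
by move=> i; apply: integral_ge0 => z _; exact: H0.
Qed.

(** Bounded overlap bounds each integral of [F i] by [N%:R * G], and the weights sum with ratio 3/4,
    whence the factor 4. *)
Let int_Y : (\int[mu]_(z in ball x0 r) Y z <=
  (4 * N%:R * (D ^+ k * A) `^ e * G)%:E)%E.
Proof.
have mwF i : measurable_fun setT (fun z => (w i)%:E * F i z)%E.
  by apply: measurable_funeM.
rewrite integral_nneseries//; last 2 first.
- exact: borel_ball.
- by move=> i; exact: measurable_funTS.
have M0 : 0 <= (D ^+ k * A) `^ e * (N%:R * G) by rewrite !mulr_ge0 ?powR_ge0.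
have q34 : 0 <= (3 / 4 : R) < 1 by apply/andP; split; lra.
have h i : (\int[mu]_(z in ball x0 r) ((w i)%:E * F i z) <=
    ((D ^+ k * A) `^ e * (N%:R * G) * (3 / 4) ^+ i)%:E)%E.
  rewrite ge0_integralZl_EFin//; [|exact: borel_ball|exact: measurable_funTS].
  rewrite (_ : _ * _ * _ = w i * (N%:R * G)); last by rewrite /w; ring.
  by rewrite [leRHS]EFinM; apply: lee_wpmul2l; [rewrite lee_fin|exact: int_F].
apply: le_trans (nneseries_geometric_le M0 q34 _ h) _.
  by move=> i; apply: integral_ge0 => z _; exact: wF0.
by rewrite lee_fin le_eqVlt; apply/orP; left; apply/eqP; field.
Qed.

Lemma telescoped_sobolev :
  ((average mu (ball x0 r)
      (fun y => (`|u y - raverage mu (ball x0 r) u| `^ q)%:E)) `^ q^-1 <=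
   (2 * K * (4 * N%:R * D ^+ k * (D ^+ k) `^ e) `^ q^-1 * r)%:E *
     (average mu (ball x0 (Lam * r)) (fun y => g y `^ p)) `^ p^-1)%E.
Proof.
have mB := ball_measure_gt0 mms x0 r0; have mL := ball_measure_gt0 mms x0 Lam0.
have Dk0 : 0 <= D ^+ k by rewrite exprn_ge0// ltW.
set Z := 4 * N%:R * D ^+ k * (D ^+ k) `^ e.
have Z0 : 0 <= Z by rewrite mulr_ge0 ?powR_ge0// mulr_ge0// mulr_ge0.
have AE : (average mu (ball x0 (Lam * r)) (fun y => g y `^ p) = A%:E)%E.
  by rewrite averageE// GE -EFinM mulrC.
have KR0 : 0 <= 2 * (K * r) by apply: mulr_ge0 => //; apply: mulr_ge0; exact: ltW.
set f := fun y => (`|u y - raverage mu (ball x0 r) u| `^ q)%:E.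
have mf : measurable_fun setT f.
  apply/measurable_EFinP; apply: (measurableT_comp (measurable_powR q)).
  by have /measurable_EFinP := mdev (raverage mu (ball x0 r) u).
have f0 y : (0 <= f y)%E by rewrite lee_fin powR_ge0.
have mY : measurable_fun setT Y.
  by apply: mseries => // i; apply: measurable_funeM.
have Y0 z : (0 <= Y z)%E by apply: nneseries_ge0 => i _ _; exact: wF0.
have h1 : (\int[mu]_(y in ball x0 r) f y <=
    ((2 * (K * r)) `^ q * (4 * N%:R * (D ^+ k * A) `^ e * G))%:E)%E.
  apply: (@le_trans _ _ (\int[mu]_(y in ball x0 r) (((2 * (K * r)) `^ q)%:E * Y y))%E).
    apply: ae_ge0_le_integral => //.
    - exact: borel_ball.
    - exact: measurable_funTS.
    - by move=> y _; rewrite mule_ge0// lee_fin powR_ge0.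
    - by apply: measurable_funTS; apply: measurable_funeM.
    - have := H_fin; apply: filterS => z hz xz; exact: pointwise (hz xz).
  rewrite ge0_integralZl_EFin ?powR_ge0//; [|exact: borel_ball|exact: measurable_funTS].
  by rewrite EFinM; apply: lee_wpmul2l; [rewrite lee_fin powR_ge0|exact: int_Y].
have h2 : (average mu (ball x0 r) f <= ((2 * (K * r)) `^ q * (Z * A `^ (1 + e)))%:E)%E.
  rewrite averageE//.
  apply: le_trans (lee_wpmul2l _ h1) _; first by rewrite lee_fin invr_ge0 ltW.
  rewrite -EFinM lee_fin mulrCA; apply: ler_wpM2l; first exact: powR_ge0.
  have GA : G = A * m x0 (Lam * r) by rewrite /A divfK// gt_eqF.
  have mLB : m x0 (Lam * r) <= D ^+ k * m x0 r.
    apply: le_trans (doubling_iter D1 muD k x0 r0).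
    apply: ball_measure_le => //; first by rewrite mulr_gt0// exprn_gt0.
    by apply: le_ball; apply: le_trans Lam_k; rewrite lerDl ltW.
  have -> : A `^ (1 + e) = A * A `^ e.
    by rewrite -[in RHS](addrK 1 e) mulr_powRB1 ?addr_gt0// addrC.
  rewrite powRM//.
  have -> : Z * (A * A `^ e) = 4 * N%:R * ((D ^+ k) `^ e) * A `^ e * A * D ^+ k.
    by rewrite /Z; ring.
  have -> : (m x0 r)^-1 * (4 * N%:R * ((D ^+ k) `^ e * A `^ e) * G) =
      4 * N%:R * ((D ^+ k) `^ e) * A `^ e * A * (m x0 (Lam * r) / m x0 r).
    by rewrite GA; ring.
  apply: ler_wpM2l; first by rewrite !mulr_ge0 ?powR_ge0.
  by rewrite ler_pdivrMr.
have q10 : 0 <= q^-1 by rewrite invr_ge0 ltW.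
have av0 : (0 <= average mu (ball x0 r) f)%E by exact: average_ge0.
apply: le_trans (le_poweR q10 av0 h2) _; rewrite AE !poweR_EFin -EFinM lee_fin.
rewrite powRM ?powR_ge0 ?mulr_ge0 ?powR_ge0//.
rewrite (powRM _ Z0) ?powR_ge0// -!powRrM mulfV ?gt_eqF// powRr1//.
(* The definition of [q] is exactly what makes the [q]-th root restore the exponent [p^-1]. *)
have -> : (1 + e) / q = p^-1.
  by field; rewrite (gt_eqF p0) gt_eqF// addr_gt0.
by rewrite le_eqVlt; apply/orP; left; apply/eqP; ring.
Qed.

End telescope.

(** * Assembling the two implications *)

Section equivalence.
Context {R : realType} {d : measure_display} {X : borelMetricType R d}.
Variable mu : {measure set X -> \bar R}.
Hypothesis mms : metric_measure_space mu.
Variable p : R.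
Hypothesis p1 : 1 <= p.

(** Scale 0 is given the single centre [x], so that the telescoping starts at the average over the
    whole ball. *)
Lemma net_family_exists (D : R) (x : X) (r : R) : 1 <= D ->
  (forall (y : X) (s : R), 0 < s ->
    fine (mu (ball y (2 * s))) <= D * fine (mu (ball y s))) -> 0 < r ->
  exists net : nat -> seq X, [/\ forall i, dispersed (r / 4 ^+ i) (net i),
    forall i c, c \in net i -> ball x r c,
    forall i z, ball x r z -> exists2 c, c \in net i & ball c (r / 4 ^+ i) z &
    net 0%N = [:: x]].
Proof.
move=> D1 muD r0.
have /choice[net netP] : forall i, exists l : seq X, [/\ dispersed (r / 4 ^+ i) l,
    (forall c, c \in l -> ball x r c),
    (forall z, ball x r z -> exists2 c, c \in l & ball c (r / 4 ^+ i) z) &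
    i = 0%N -> l = [:: x]].
  move=> [|i].
    exists [:: x]; split => //.
      by move=> c; rewrite inE => /eqP ->; exact: ballxx.
    by move=> z xz; exists x; rewrite ?inE// expr0 divr1.
  have ri : 0 < r / 4 ^+ i.+1 by rewrite divr_gt0// exprn_gt0.
  by have [l [h1 h2 h3]] := net_exists mms D1 muD x ri r0; exists l.
exists net; split => [i|i|i|]; try by have [] := netP i.
by have [_ _ _ ->] := netP 0%N.
Qed.

Lemma powR_le_exists (a b : R) : 1 <= a -> 1 < b -> exists2 e : R, 0 < e & a `^ e <= b.
Proof.
move=> a1 b1; have a10 : 1 < a + 1 by rewrite ltrDr (lt_le_trans _ a1).
have a0 : 0 < a + 1 by rewrite (lt_trans _ a10).
exists (ln b / ln (a + 1)); first by rewrite divr_gt0// ln_gt0.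
apply: (@le_trans _ _ ((a + 1) `^ (ln b / ln (a + 1)))).
  apply: ge0_ler_powR; rewrite ?nnegrE ?lerDl//.
  - by rewrite divr_ge0// ltW// ln_gt0.
  - by rewrite (le_trans _ a1).
  - exact: ltW.
by rewrite /powR gt_eqF// divfK ?gt_eqF ?ln_gt0// lnK// posrE (lt_trans _ b1).
Qed.

Lemma poincare_sobolev : doubling mu -> supports_poincare mu p ->
  exists q CP sigma : R, [/\ p < q, 1 <= CP, 1 <= sigma &
    forall (x : X) (r : R) (u : X -> R) (g : X -> \bar R),
      0 < r -> L1loc mu u -> upper_gradient u g ->
      ((average mu (ball x r)
          (fun y => (`|u y - raverage mu (ball x r) u| `^ q)%:E)) `^ q^-1 <=
       (CP * r)%:E *
         (average mu (ball x (sigma * r)) (fun y => g y `^ p)) `^ p^-1)%E].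
Proof.
move=> [C1 C10 dbl] [C [sigma [C0 sigma1 poinc]]].
have p0 : 0 < p by rewrite (lt_le_trans _ p1).
pose D := Num.max 1 C1.
have D1 : 1 <= D by rewrite le_max lexx.
have muD (x : X) (r : R) : 0 < r ->
    fine (mu (ball x (2 * r))) <= D * fine (mu (ball x r)).
  move=> r0; have r20 : 0 < 2 * r by rewrite mulr_gt0.
  have := dbl x r r0.
  rewrite (ball_measureE mms x r20) (ball_measureE mms x r0) -EFinM lee_fin.
  move=> /le_trans; apply; apply: ler_wpM2r; first exact/ltW/ball_measure_gt0.
  by rewrite le_max lexx orbT.
pose k := Num.bound (8 * sigma + 1).
have hk : 8 * sigma + 1 <= 2 ^+ k by apply: ltW; exact: upper_nthrootP.
pose N := Num.bound (D ^+ k).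
have hN : D ^+ k < N%:R by apply: archi_boundP; rewrite exprn_ge0// (le_trans _ D1).
(* The gain [e] in integrability depends only on the doubling constant. *)
have [e e0 De] : exists2 e : R, 0 < e & (D ^+ 2) `^ e <= 3 / 2.
  apply: powR_le_exists; first exact: exprn_ege1.
  by rewrite ltr_pdivlMr// mul1r ltr_nat.
pose q := p * (1 + e).
pose CP := 2 * (4 * D ^+ 4 * C) * (4 * N%:R * D ^+ k * (D ^+ k) `^ e) `^ q^-1.
exists q, (Num.max 1 CP), (1 + 2 * sigma); split.
- by rewrite /q ltr_pMr// ltrDl.
- by rewrite le_max lexx.
- by rewrite lerDl mulr_ge0// (le_trans _ sigma1).
move=> x r u g r0 lu ug; have [mg _ _] := ug.
have L0 : 0 < (1 + 2 * sigma) * r.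
  by rewrite mulr_gt0// addr_gt0// mulr_gt0// (lt_le_trans _ sigma1).
have CPr0 : 0 < Num.max 1 CP * r by rewrite mulr_gt0// lt_max ltr01.
have I0 : (0 <= \int[mu]_(y in ball x ((1 + 2 * sigma) * r)) (g y `^ p))%E.
  by apply: integral_ge0 => y _; exact: poweR_ge0.
(* Infinite energy makes the right-hand side infinite; otherwise the energy is the real number [G]
   of the telescoping argument. *)
have [Iy|Ifin] := eqVneq (\int[mu]_(y in ball x ((1 + 2 * sigma) * r)) (g y `^ p))%E +oo%E.
  rewrite (averageE mms x _ L0) Iy gt0_muley; last first.
    by rewrite lte_fin invr_gt0 ball_measure_gt0.
  rewrite poweRyr ?invr_eq0 ?gt_eqF// gt0_muley ?leey//.
have IE : (\int[mu]_(y in ball x ((1 + 2 * sigma) * r)) (g y `^ p) =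
    (fine (\int[mu]_(y in ball x ((1 + 2 * sigma) * r)) (g y `^ p)))%:E)%E.
  by rewrite fineK// ge0_fin_numE// ltey.
have [net [net1 net2 net3 net4]] := net_family_exists x D1 muD r0.
have poinc' (y : X) (s : R) : 0 < s -> _ := fun s0 => poinc y s u g s0 lu ug.
have h := telescoped_sobolev mms D1 muD p1 C0 sigma1 lu mg poinc' r0 hk hN IE
  net1 net2 net3 net4 e0 De.
apply: (le_trans h); apply: lee_wpmul2r; first exact: poweR_ge0.
rewrite lee_fin; apply: ler_wpM2r; first exact: ltW.
by rewrite le_max lexx orbT.
Qed.

Lemma sobolev_poincare (q CP sigma : R) : p < q -> 1 <= CP -> 1 <= sigma ->
  (forall (x : X) (r : R) (u : X -> R) (g : X -> \bar R),
    0 < r -> L1loc mu u -> upper_gradient u g ->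
    ((average mu (ball x r)
        (fun y => (`|u y - raverage mu (ball x r) u| `^ q)%:E)) `^ q^-1 <=
     (CP * r)%:E *
       (average mu (ball x (sigma * r)) (fun y => g y `^ p)) `^ p^-1)%E) ->
  supports_poincare mu p.
Proof.
move=> pq CP1 sigma1 sob; have CP0 : 0 < CP by rewrite (lt_le_trans _ CP1).
exists (2 * CP), sigma; split => //; first by rewrite mulr_gt0.
move=> x r u g r0 lu ug; set uB := raverage _ _ _.
have q1 : 1 <= q by rewrite (le_trans p1)// ltW.
have mh : measurable_fun setT (fun y => `|u y - uB|).
  apply: measurableT_comp => //.
  by apply: measurable_funB; [case: lu|exact: measurable_cst].
apply: le_trans (average_le_powR mms x r0 q1 mh (fun y => normr_ge0 _)) _.
rewrite -mulrA EFinM -muleA; apply: lee_wpmul2l; first by rewrite lee_fin.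
exact: sob.
Qed.

End equivalence.

Theorem theorem1 (R : realType) (d : measure_display) (X : borelMetricType R d)
    (mu : {measure set X -> \bar R}) (p : R) :
  metric_measure_space mu -> 1 <= p ->
  (doubling mu /\ supports_poincare mu p) <->
  (exists q CP sigma : R, [/\ p < q, 1 <= CP, 1 <= sigma &
    forall (x : X) (r : R) (u : X -> R) (g : X -> \bar R),
      0 < r -> L1loc mu u -> upper_gradient u g ->
      ((average mu (ball x r)
          (fun y => (`|u y - raverage mu (ball x r) u| `^ q)%:E)) `^ q^-1 <=
       (CP * r)%:E *
         (average mu (ball x (sigma * r)) (fun y => g y `^ p)) `^ p^-1)%E]).
Proof.
move=> mms p1; split; first by move=> [dbl poinc]; exact: poincare_sobolev.
move=> [q [CP [sigma [pq CP1 sigma1 sob]]]]; split.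
  exact: (sobolev_doubling mms p1 pq CP1 sigma1 sob).
exact: (sobolev_poincare mms p1 pq CP1 sigma1 sob).
Qed.
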